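(* Let $n\ge 2$. If $A\subseteq\mathfrak{S}_n$ is Schur-positive and invariant under horizontal rotation (i.e. $A=Ac_n$), then $A$ is cyclic Schur-positive.
   Context: Permutations are in one-line notation, composed right to left; $c_n=(1,2,\dots,n)=23\cdots n1$ and $Ac_n=\{\sigma c_n:\sigma\in A\}$. For $\pi\in\mathfrak{S}_n$, $\mathrm{Des}(\pi)=\{i\in[n-1]:\pi(i)>\pi(i+1)\}$, $\mathrm{cDes}(\pi)=\{i\in[n]:\pi(i)>\pi(i+1)\}$ with $\pi(n+1):=\pi(1)$. $\mathbf{x}^J=\prod_{i\in J}x_i$; $i+J=\{i+j\bmod n:j\in J\}\subseteq[n]$. Schur-positive: $\sum_{\pi\in A}\mathcal{F}_{n,\mathrm{Des}(\pi)}$ is symmetric and Schur-nonnegative, where $\mathcal{F}_{n,D}=\sum x_{i_1}\cdots x_{i_n}$ over $i_1\le\cdots\le i_n$ with $i_j<i_{j+1}$ for $j\in D$. Cyclic Schur-positive: for a skew shape $\lambda/\mu$ with $n$ cells, $\mathrm{Des}(T)$ for $T\in\mathrm{SYT}(\lambda/\mu)$ is the set of $i\in[n-1]$ with $i+1$ in a strictly lower row than $i$. A cyclic descent extension on $\mathrm{SYT}(\lambda/\mu)$ is a pair $(\mathrm{cDes},\psi)$ with $\mathrm{cDes}(T)\cap[n-1]=\mathrm{Des}(T)$, $\mathrm{cDes}(\psi T)=1+\mathrm{cDes}(T)$, $\emptyset\ne\mathrm{cDes}(T)\ne[n]$ ($\psi$ a bijection); it exists iff $\lambda/\mu$ is not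 a connected ribbon, and $\sum_T\mathbf{x}^{\mathrm{cDes}(T)}$ is independent of the choice. $A$ is cyclic Schur-positive if $\sum_{\pi\in A}\mathbf{x}^{\mathrm{cDes}(\pi)}=\sum m_{\lambda/\mu}\sum_{T\in\mathrm{SYT}(\lambda/\mu)}\mathbf{x}^{\mathrm{cDes}(T)}$ for some nonnegative integers $m_{\lambda/\mu}$ indexed by skew shapes with $n$ cells that are not connected ribbons. *)

(* Defs.v *)
From HB Require Import structures.
From mathcomp Require Import all_boot all_order all_algebra all_fingroup.
From mathcomp Require Import mpoly.
Set Implicit Arguments. Unset Strict Implicit. Unset Printing Implicit Defensive.
Import GRing.Theory.
Local Open Scope ring_scope.

(* Conventions: [n] = {1..n} is represented by 'I_n, the ordinal i standing
   for i+1.  A permutation pi of [n] in one-line notation is s : 'S_n with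
   pi(i+1) = s(i) + 1 (order preserving, so descents agree).
   Subsets J of [n] are {set 'I_n}; [n-1] is the set of ordinals i with i+1<n.
   The cyclic shift i |-> i+1 mod n on [n] is ordS. *)

Section Defs.
Variable n : nat.

Definition nm1 : {set 'I_n} := [set i : 'I_n | i.+1 < n]%N.

Definition shift1 (J : {set 'I_n}) : {set 'I_n} := [set ordS i | i in J].

Definition Des (s : 'S_n) : {set 'I_n} :=
  [set i : 'I_n | (i.+1 < n)%N && (s (ordS i) < s i)%N].
Definition cDesP (s : 'S_n) : {set 'I_n} :=
  [set i : 'I_n | (s (ordS i) < s i)%N].

Definition cn : 'S_n := perm (@ordS_inj n).

(* A c_n = { sigma c_n : sigma in A } where sigma c_n = sigma o c_n
   (composition right to left).  In mathcomp, (s * t) x = t (s x),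
   so sigma o c_n is (cn * sigma)%g. *)
Definition rotA (A : {set 'S_n}) : {set 'S_n} := [set (cn * s)%g | s in A].

(* polynomials in n commuting variables x_1..x_n (x_{i+1} = 'X_i) *)
Definition x_set (J : {set 'I_n}) : {mpoly int[n]} := \prod_(i in J) 'X_i.

(* fundamental quasisymmetric function F_{n,D}, in N = n variables:
   sum of x_{i_1}...x_{i_n} over i_1 <= ... <= i_n with i_j < i_{j+1}
   for j in D. *)
Definition Fund (D : {set 'I_n}) : {mpoly int[n]} :=
  \sum_(s : {ffun 'I_n -> 'I_n} |
        [forall j : 'I_n, (j.+1 < n)%N ==>
           (if j \in D then (s j < s (ordS j))%N else (s j <= s (ordS j))%N)])
    \prod_(j : 'I_n) 'X_(s j).
End Defs.

Definition is_partition (l : seq nat) : bool :=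
  sorted geq l && all (fun k => 0 < k)%N l.

Definition subshape (mu la : seq nat) : bool :=
  (size mu <= size la)%N && all (fun i => nth 0 mu i <= nth 0 la i)%N (iota 0 (size la)).

Definition is_skew (la mu : seq nat) : bool :=
  [&& is_partition la, is_partition mu & subshape mu la].

(* cells (row, column) of lambda/mu, rows numbered from the top (English) *)
Definition cells (la mu : seq nat) : seq (nat * nat) :=
  [seq (i, j) | i <- iota 0 (size la),
                j <- iota (nth 0 mu i) (nth 0 la i - nth 0 mu i)].

Definition adjacent (c d : nat * nat) : bool :=
  ((c.1 == d.1) && ((c.2.+1 == d.2) || (d.2.+1 == c.2))) ||
  ((c.2 == d.2) && ((c.1.+1 == d.1) || (d.1.+1 == c.1))).

Definition connected_shape (la mu : seq nat) : Prop :=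
  forall P : pred (nat * nat),
    has P (cells la mu) -> has (predC P) (cells la mu) ->
    exists c d, [/\ c \in cells la mu, d \in cells la mu, adjacent c d, P c & ~~ P d].

Definition has_square (la mu : seq nat) : bool :=
  has (fun c => [&& (c.1, c.2.+1) \in cells la mu, (c.1.+1, c.2) \in cells la mu
                  & (c.1.+1, c.2.+1) \in cells la mu]) (cells la mu).

Definition connected_ribbon (la mu : seq nat) : Prop :=
  connected_shape la mu /\ ~~ has_square la mu.

(* A standard Young tableau T of shape lambda/mu with n cells is encoded as
   the sequence of its cells ordered by entry: the k-th item (k from 0) is
   the cell containing the entry k+1.  Standardness: it lists every cell
   exactly once, and entries increase along rows and down columns. *)
Definition is_SYT (la mu : seq nat) (T : seq (nat * nat)) : bool :=
  perm_eq T (cells la mu) &&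
  all (fun c : nat * nat =>
         (((c.1, c.2.+1) \in T) ==> (index c T < index (c.1, c.2.+1) T)%N) &&
         (((c.1.+1, c.2) \in T) ==> (index c T < index (c.1.+1, c.2) T)%N)) T.

Definition SYT (la mu : seq nat) : seq (seq (nat * nat)) :=
  [seq T <- permutations (cells la mu) | is_SYT la mu T].

Definition DesT (n : nat) (T : seq (nat * nat)) : {set 'I_n} :=
  [set i : 'I_n | (i.+1 < n)%N && ((nth (0,0) T i).1 < (nth (0,0) T i.+1).1)%N].

Definition cyc_desc_ext (n : nat) (la mu : seq nat)
    (cD : seq (nat * nat) -> {set 'I_n}) (psi : seq (nat * nat) -> seq (nat * nat)) : Prop :=
  [/\ {in SYT la mu, forall T, cD T :&: nm1 n = DesT n T},
      {in SYT la mu, forall T, psi T \in SYT la mu},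
      (exists2 psi', {in SYT la mu, forall T, psi' T \in SYT la mu} &
         {in SYT la mu, cancel psi psi'} /\ {in SYT la mu, cancel psi' psi}),
      {in SYT la mu, forall T, cD (psi T) = shift1 (cD T)} &
      {in SYT la mu, forall T, cD T != set0 /\ cD T != [set: 'I_n]}].

(* Schur polynomial s_lambda in n variables: sum over semistandard tableaux
   of shape lambda with entries in [n] (entry of the k-th cell of
   cells la [::] is t k). *)
Definition is_SSYT (n : nat) (la : seq nat) (t : {ffun 'I_(size (cells la [::])) -> 'I_n}) : bool :=
  [forall k : 'I_(size (cells la [::])), forall l : 'I_(size (cells la [::])),
     let c := nth (0,0) (cells la [::]) k in
     let d := nth (0,0) (cells la [::]) l in
     ((d == (c.1, c.2.+1)) ==> (t k <= t l)%N) &&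
     ((d == (c.1.+1, c.2)) ==> (t k < t l)%N)].

Definition schur (n : nat) (la : seq nat) : {mpoly int[n]} :=
  \sum_(t : {ffun 'I_(size (cells la [::])) -> 'I_n} | @is_SSYT n la t)
    \prod_(k : 'I_(size (cells la [::]))) 'X_(t k).

Definition schur_positive (n : nat) (A : {set 'S_n}) : Prop :=
  let Q := \sum_(s in A) Fund (Des s) in
  Q \is symmetric /\
  exists L : seq (seq nat),
    all (fun la => is_partition la && (sumn la == n)) L /\
    Q = \sum_(la <- L) schur n la.

Definition cyclic_schur_positive (n : nat) (A : {set 'S_n}) : Prop :=
  exists L : seq (seq nat * seq nat),
  exists cD : seq nat * seq nat -> seq (nat * nat) -> {set 'I_n},
    [/\ forall sh, sh \in L ->
          [/\ is_skew sh.1 sh.2, size (cells sh.1 sh.2) = n,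
              ~ connected_ribbon sh.1 sh.2 &
              exists psi, cyc_desc_ext sh.1 sh.2 (cD sh) psi] &
        \sum_(s in A) x_set (cDesP s) =
        \sum_(sh <- L) \sum_(T <- SYT sh.1 sh.2) x_set (cD sh T)].

(* Main.v *)
Require Import Defs.
From HB Require Import structures.
From mathcomp Require Import all_boot all_order all_algebra all_fingroup.
From mathcomp Require Import zify ring lra.
From mathcomp Require Import mpoly.
Set Implicit Arguments. Unset Strict Implicit. Unset Printing Implicit Defensive.
Import Order.TTheory GRing.Theory Num.Theory.

(** Call [c] a cyclic lift of a descent count [d] if [c] is invariant under
rotation of subsets, [c J + c (J + {n}) = d J] for [J] in [[n-1]], and [c] kills
the empty and the full set.  A shape carries a cyclic descent extension as soon
as its descent count has a cyclic lift, and the cyclic descents of a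
rotation-invariant [A] form a cyclic lift of its descents.

For a partition that is not a hook, the lift is built by linear algebra.  In
Young's seminormal form, let [U_i] be the space fixed by the simple reflection
[s_i], and complete the family by one more space, the rotation of the last [U_i]
under the Coxeter element; the rotation then permutes the [U_i] cyclically.
After removal of any single member the family is spanned by parts of one basis,
indexed by tableaux according to their descents.  The number [q J] of dimensions
of the intersection over [J] that do not come from larger intersections satisfies
[q J + q (J + k) = d_k J + f J k] with an error [f] that, by modularity, depends
on [#|J|] only.  It vanishes because no tableau of a non-hook shape has an
initial segment as descent or ascent set.

Subtracting these lifts from the cyclic descent count of [A] leaves a function of
[#|J|] alone, since the descent count of a hook is one.  Its value at [k] can be
read off at the initial segment of size [k], where the non-hook lifts vanish, so
it is nonnegative; it is the number of copies to take of the disjoint union of a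
column of length [k] and a row of length [n - k]. *)

(** * Families of subspaces that are coordinate for rotating bases *)

(** Starting from the value 0 at the empty set, the recursion alone determines a lift, but as an
    alternating sum of descent counts, whose sign is not visible. Realising it as a dimension of a
    quotient makes it nonnegative by construction. A basis adapted to all n spaces at once would
    give the recursion immediately; only bases adapted to all spaces but one are at hand, and
    [defect] measures what this costs. Since the vectors fixed by a reflection are indexed by
    tableaux without a descent there, the spaces record ascents, and the lift is read off at
    complementary sets. Hooks stand apart because they are connected ribbons and carry no cyclic
    descent extension. They can only enter in pairs: a column of length k beside a row of length n -
    k has the descent count of the two hooks with legs k and k - 1. Rotation invariance of [A] is
    what makes this pairing possible. *)

Section Spans.
Variables (F : fieldType) (vT : vectType F) (X : finType) (b : X -> vT).

Definition span_of (S : {set X}) : {vspace vT} := (\sum_(T in S) <[b T]>)%VS.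

Lemma span_ofS (S S' : {set X}) : S \subset S' -> (span_of S <= span_of S')%VS.
Proof.
move=> sSS'; apply/subv_sumP=> T TS.
by apply: (sumv_sup T) => //; apply: (subsetP sSS').
Qed.

Lemma span_ofU S S' : span_of (S :|: S') = (span_of S + span_of S')%VS.
Proof.
apply/eqP; rewrite eqEsubv subv_add !span_ofS ?subsetUl ?subsetUr // !andbT.
apply/subv_sumP=> T; rewrite inE => /orP[] TS.
  by apply: subv_trans (addvSl _ _); apply: (sumv_sup T).
by apply: subv_trans (addvSr _ _); apply: (sumv_sup T).
Qed.

Lemma span_of0 : span_of set0 = 0%VS.
Proof. by rewrite /span_of big_set0. Qed.

Hypothesis b_span : span_of setT = fullv.
Hypothesis b_dim : \dim {:vT} = #|X|.

(** Every span has at most as many dimensions as generators, and the spans of [S] and of its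
    complement together fill a space of dimension [#|X|], so neither bound can be strict. *)
Lemma dim_span_of S : \dim (span_of S) = #|S|.
Proof.
have le (R : {set X}) : (\dim (span_of R) <= #|R|)%N.
  apply: leq_trans (dimv_leq_sum _ _ _) _.
  by rewrite -sum1_card leq_sum // => T _; rewrite dim_vline leq_b1.
have := dimv_sum_cap (span_of S) (span_of (~: S)).
rewrite -span_ofU setUCr b_span b_dim -(cardsC S).
by move: (le S) (le (~: S)); lia.
Qed.

Lemma span_ofI S S' : span_of (S :&: S') = (span_of S :&: span_of S')%VS.
Proof.
apply/eqP; rewrite eqEdim subv_cap !span_ofS ?subsetIl ?subsetIr //=.
have := dimv_sum_cap (span_of S) (span_of S').
rewrite -span_ofU !dim_span_of; have := cardsUI S S'; lia.
Qed.

Lemma span_of_bigcap (J : finType) (P : pred J) (S : J -> {set X}) :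
  span_of (\bigcap_(j | P j) S j) = (\bigcap_(j | P j) span_of (S j))%VS.
Proof. exact: (big_morph span_of span_ofI b_span). Qed.

Lemma span_of_bigcup (J : finType) (P : pred J) (S : J -> {set X}) :
  span_of (\bigcup_(j | P j) S j) = (\sum_(j | P j) span_of (S j))%VS.
Proof. exact: (big_morph span_of span_ofU span_of0). Qed.

End Spans.

Section AlmostDistributive.
Variables (F : fieldType) (vT : vectType F) (I X : finType).
Variables (U : I -> {vspace vT}) (b : I -> X -> vT) (P : I -> X -> {set I}).
Hypothesis b_span : forall k, span_of (b k) setT = fullv.
Hypothesis b_dim : \dim {:vT} = #|X|.
Hypothesis UE : forall k i, i != k -> U i = span_of (b k) [set T | i \in P k T].
Hypothesis P_omits : forall k T, k \notin P k T.

Definition meet (J : {set I}) : {vspace vT} := (\bigcap_(i in J) U i)%VS.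
(** [K] lists the indices that may not be added. For [K = J] this is the part of [meet J] coming
    from larger index sets; putting [k] into [K] keeps only meets that the basis [b k] can
    describe. *)
Definition above (J K : {set I}) : {vspace vT} :=
  (\sum_(j | j \notin K) meet (j |: J))%VS.
Definition excess (J : {set I}) : nat := \dim (meet J) - \dim (above J J).
Definition exact_count k (J : {set I}) : nat := #|[set T | P k T == J]|.

Lemma meetE k (J : {set I}) : k \notin J ->
  meet J = span_of (b k) [set T | J \subset P k T].
Proof.
move=> kJ; rewrite /meet.
under eq_bigr => i iJ.
  rewrite (@UE k); last by apply: contraNneq kJ => <-.
  over.
rewrite -span_of_bigcap //; congr (span_of _ _); apply/setP=> T; rewrite inE.
apply/bigcapP/subsetP => H i iJ; first by have := H i iJ; rewrite inE.
by rewrite inE H.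
Qed.

Lemma aboveE k (J K : {set I}) : k \notin J -> k \in K ->
  above J K =
  span_of (b k) [set T | [exists j, (j \notin K) && (j |: J \subset P k T)]].
Proof.
move=> kJ kK; rewrite /above.
under eq_bigr => j jK.
  rewrite (@meetE k); last first.
    by rewrite !inE negb_or kJ andbT; apply: contraNneq jK => <-.
  over.
rewrite -span_of_bigcup //; congr (span_of _ _); apply/setP=> T; rewrite inE.
apply/bigcupP/existsP => [[j jK]|[j /andP[jK H]]].
  by rewrite inE => H; exists j; rewrite jK.
by exists j; rewrite // inE.
Qed.

Lemma meetS (J K : {set I}) : J \subset K -> (meet K <= meet J)%VS.
Proof.
move=> sJK; apply/subv_bigcapP => i iJ.
by apply: (bigcapv_inf i) => //; apply: (subsetP sJK).
Qed.

Lemma above_le J K : (above J K <= meet J)%VS.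
Proof. by apply/subv_sumP => j _; apply: meetS; apply: subsetUr. Qed.

Lemma aboveD1 (J K : {set I}) k : k \in K ->
  above J (K :\ k) = (above J K + meet (k |: J))%VS.
Proof.
move=> kK; rewrite /above (bigD1 k) /=; last by rewrite !inE eqxx.
rewrite addvC; congr (_ + _)%VS; apply: eq_bigl => j; rewrite !inE.
by have [->|] := eqVneq j k; rewrite ?kK ?andbT ?andbF.
Qed.

(** In the basis [b k] the meet consists of the [T] with [J] inside [P k T], and [above] of those
    where the inclusion is proper; the extra element is never [k], by [P_omits]. *)
Lemma exact_countE k (J : {set I}) : k \notin J ->
  \dim (meet J) = exact_count k J + \dim (above J (k |: J)).
Proof.
move=> kJ; rewrite (meetE kJ) (aboveE kJ) ?setU11 // !dim_span_of //.
rewrite -[LHS](cardsID [set T | P k T == J]); congr (_ + _)%N.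
  by apply: eq_card => T; rewrite !inE; case: eqP => [->|]; rewrite ?subxx ?andbF.
apply: eq_card => T; rewrite !inE; apply/andP/existsP.
  case=> nPJ sJP; have /subsetPn[j jP jJ] : ~~ (P k T \subset J).
    by apply: contraNN nPJ => sPJ; rewrite eqEsubset sPJ.
  exists j; rewrite subUset sub1set jP sJP !inE negb_or jJ !andbT.
  by apply: contraTneq jP => ->; apply: P_omits.
case=> j /andP[]; rewrite !inE negb_or subUset sub1set => /andP[_ jJ] /andP[jP sJP].
by split=> //; apply: contraNneq jJ => <-.
Qed.

(** The index [l] occurs in none of the meets involved, so all spaces are coordinate in the basis
    [b l], where intersection distributes over sum. *)
Lemma meet_above_distr (J : {set I}) k l : k != l -> k \notin J -> l \notin J ->
  (meet (k |: J) :&: above J (k |: (l |: J)))%VS = above (k |: J) (k |: (l |: J)).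
Proof.
move=> kl kJ lJ.
have lkJ : l \notin k |: J by rewrite !inE negb_or eq_sym kl.
rewrite (meetE lkJ) (aboveE lJ) ?(aboveE lkJ) ?inE ?eqxx ?orbT // -span_ofI //.
congr (span_of _ _); apply/setP=> T; rewrite !inE; apply/andP/existsP.
  case=> skP /existsP[j /andP[jn sjP]]; exists j; rewrite jn /=.
  by move: skP sjP; rewrite !subUset => /andP[-> _] /andP[-> ->].
case=> j /andP[jn]; rewrite !subUset => /and3P[jP kP JP].
by rewrite kP JP; split=> //; apply/existsP; exists j; rewrite jn subUset jP JP.
Qed.

Lemma setU1DK (J : {set I}) k : k \notin J -> (k |: J) :\ k = J.
Proof.
by move=> kJ; apply/setP=> i; rewrite !inE; case: eqP => // ->; rewrite (negbTE kJ).
Qed.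

(* The failure of distributivity of [meet (k |: J)] over the remaining meets. *)
Definition defect (J : {set I}) k : nat :=
  \dim (meet (k |: J) :&: above J (k |: J))%VS - \dim (above (k |: J) (k |: J)).

Lemma defect_le (J : {set I}) k : k \notin J ->
  (\dim (above (k |: J) (k |: J)) <= \dim (meet (k |: J) :&: above J (k |: J))%VS)%N.
Proof.
move=> kJ; apply: dimvS; rewrite subv_cap above_le /=.
apply/subv_sumP=> j jn; apply: (sumv_sup j) => //.
by apply: meetS; rewrite setUS // subsetUr.
Qed.

(** This is the dimension formula for [above J J], the sum of [above J (k |: J)] and
    [meet (k |: J)]; their intersection accounts for [defect]. *)
Lemma excess_add (J : {set I}) k : k \notin J ->
  excess J + excess (k |: J) = exact_count k J + defect J k.
Proof.
move=> kJ; have dJ := exact_countE kJ; have le := defect_le kJ.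
have := dimv_sum_cap (meet (k |: J)) (above J (k |: J)).
rewrite addvC -aboveD1 ?setU11 // setU1DK //.
have l1 := dimvS (above_le J J).
have l2 := dimvS (above_le (k |: J) (k |: J)).
rewrite /excess /defect; lia.
Qed.

Lemma excess_le (J : {set I}) k : k \notin J -> (excess J <= exact_count k J)%N.
Proof.
move=> kJ; rewrite /excess (exact_countE kJ).
suff /dimvS : (above J (k |: J) <= above J J)%VS by lia.
by rewrite -[X in (_ <= above _ X)%VS](setU1DK kJ) aboveD1 ?setU11 // addvSl.
Qed.

(* In terms of X, Y, Z (the meets at k, at l, and the sum of the others), both
   sides are expressions symmetric in X and Y. *)
Lemma exchange (J : {set I}) k l : k != l -> k \notin J -> l \notin J ->
  defect J k = defect J l /\
  exact_count k J + exact_count k (l |: J) =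
  exact_count l J + exact_count l (k |: J).
Proof.
move=> kl kJ lJ.
have lkJ : l \notin k |: J by rewrite !inE negb_or eq_sym kl.
have klJ : k \notin l |: J by rewrite !inE negb_or kl.
have lk : l != k by rewrite eq_sym.
pose K := k |: (l |: J).
have KE : l |: (k |: J) = K by rewrite /K setUCA.
have eK : K :\ l = k |: J by rewrite -KE setU1DK.
have eL : K :\ k = l |: J by rewrite setU1DK.
have Kk : k \in K by rewrite setU11.
have Kl : l \in K by rewrite -KE setU11.
have Ak : above J (k |: J) = (above J K + meet (l |: J))%VS by rewrite -eK aboveD1.
have Al : above J (l |: J) = (above J K + meet (k |: J))%VS by rewrite -eL aboveD1.
have Bk : above (k |: J) (k |: J) = (above (k |: J) K + meet K)%VS.
  by rewrite -{2}eK aboveD1 // KE.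
have Bl : above (l |: J) (l |: J) = (above (l |: J) K + meet K)%VS.
  by rewrite -{2}eL aboveD1.
have Dk : (meet (k |: J) :&: above J K)%VS = above (k |: J) K.
  exact: meet_above_distr.
have Dl : (meet (l |: J) :&: above J K)%VS = above (l |: J) K.
  by have := meet_above_distr lk lJ kJ; rewrite KE.
have XY : (meet (k |: J) :&: meet (l |: J))%VS = meet K.
  apply/eqP; rewrite eqEsubv subv_cap !meetS ?subsetUr // -?KE ?subsetUr //= andbT.
  apply/subv_bigcapP=> i; rewrite KE !inE => /or3P[/eqP->|/eqP->|iJ].
  - by apply: subv_trans (capvSl _ _) _; apply: (bigcapv_inf k); rewrite ?setU11.
  - by apply: subv_trans (capvSr _ _) _; apply: (bigcapv_inf l); rewrite ?setU11.
  - by apply: subv_trans (capvSl _ _) _; apply: (bigcapv_inf i); rewrite ?inE ?iJ ?orbT.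
have e1 := exact_countE kJ; have e2 := exact_countE lJ.
have e3 := exact_countE lkJ; have e4 := exact_countE klJ.
rewrite KE in e3; rewrite -/K in e4.
have le1 := defect_le kJ; have le2 := defect_le lJ.
have := dimv_sum_cap (above J K) (meet (k |: J)).
have := dimv_sum_cap (above J K) (meet (l |: J)).
rewrite [(above J K :&: meet (k |: J))%VS]capvC [(above J K :&: meet (l |: J))%VS]capvC.
rewrite Dk Dl -Ak -Al => s2 s1.
have := dimv_sum_cap (above (k |: J) K) (meet K); rewrite -Bk => s3.
have := dimv_sum_cap (above (l |: J) K) (meet K); rewrite -Bl => s4.
have := dimv_sum_cap (meet (k |: J)) (above J (k |: J)).
rewrite Ak addvC -addvA [(meet (l |: J) + _)%VS]addvC addvA -Al -Ak => s5.
have := dimv_sum_cap (meet (l |: J)) (above J (l |: J)).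
rewrite Al addvC -Al => s6.
(* Both sides are the triple intersection of [meet (k |: J)], [meet (l |: J)] and [above J K]. *)
have tri : (above (k |: J) K :&: meet K)%VS = (above (l |: J) K :&: meet K)%VS.
  rewrite -Dk -Dl -XY; apply/vspaceP=> v; rewrite !memv_cap.
  by do !case: (v \in _).
rewrite tri in s3; split; last lia.
rewrite /defect; lia.
Qed.

(** Sets of equal size are joined by exchanges of a single element, so induction on [#|J :\: J'|]
    reduces to trading one [l] of [J] for one [h] of [J']. *)
Lemma defect_card (J J' : {set I}) k k' :
  #|J| = #|J'| -> k \notin J -> k' \notin J' -> defect J k = defect J' k'.
Proof.
have [m] := ubnP #|J :\: J'|; elim: m J k => // m IH J k lem cJ kJ k'J'.
have [JJ|] := eqVneq J J'.
  rewrite -JJ in k'J' *; have [->//|kk] := eqVneq k k'.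
  by case: (exchange kk kJ k'J').
move=> neq.
have nsub : ~~ (J \subset J').
  by apply: contraNN neq => s; rewrite eqEcard s cJ leqnn.
have nsub' : ~~ (J' \subset J).
  by apply: contraNN neq => s; rewrite eq_sym eqEcard s cJ leqnn.
have [l lJ lJ'] := subsetPn nsub; have [h hJ' hJ] := subsetPn nsub'.
pose K := J :\ l.
have JE : J = l |: K by rewrite setD1K.
have lK : l \notin K by rewrite !inE eqxx.
have hK : h \notin K by rewrite inE (negbTE hJ) andbF.
have hl : h != l by apply: contraNneq hJ => ->.
have lhK : l \notin h |: K by rewrite !inE negb_or eq_sym hl eqxx.
have hlK : h \notin l |: K by rewrite -JE.
have -> : defect J k = defect J h.
  by have [->//|kh] := eqVneq k h; case: (exchange kh kJ hJ).
have <- : defect (h |: K) l = defect J h.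
  (* The sum of [excess] over [K], [h |: K], [l |: K] and [h |: (l |: K)] is computed twice with
     [excess_add], pairing the four sets along [h] and along [l]. By [exchange] everything but the
     two defects in question cancels. *)
  have [d1 c1] := exchange hl hK lK; rewrite JE.
  have := excess_add hK; have := excess_add lK.
  have := excess_add lhK; have := excess_add hlK.
  rewrite [l |: (h |: K)]setUCA d1; move: c1.
  move: (excess _) (excess _) (excess _) (excess _).
  move: (exact_count _ _) (exact_count _ _) (exact_count _ _) (exact_count _ _).
  move: (defect _ _) (defect _ _) (defect _ _); clear; lia.
apply: IH => //; last by rewrite -cJ JE !cardsU1 lK hK.
rewrite ltnS in lem; apply: leq_trans lem.
rewrite (cardsD1 l (J :\: J')) !inE lJ lJ' add1n ltnS; apply: subset_leq_card.
apply/subsetP=> i; rewrite !inE; have [->|] := eqVneq i h; first by rewrite hJ'.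
by move=> _ /and3P[-> -> ->].
Qed.

(** Counts and defects are natural numbers, so one pair with vanishing excesses forces its defect to
    be 0, and [defect_card] carries this to all sets of the same size. *)
Lemma excess_recursion :
  (forall p, (p < #|I|)%N -> exists (J : {set I}) k,
     [/\ #|J| = p, k \notin J, excess J = 0 & excess (k |: J) = 0]) ->
  forall (J : {set I}) k, k \notin J ->
    excess J + excess (k |: J) = exact_count k J.
Proof.
move=> van J k kJ; rewrite (excess_add kJ).
have [|J0 [k0 [c0 k0J0 q0 q1]]] := van #|J|.
  by rewrite -cardsT; apply: proper_card; rewrite properE subsetT; apply/subsetPn; exists k.
rewrite (@defect_card J J0 k k0) //.
by have := excess_add k0J0; rewrite q0 q1; lia.
Qed.

End AlmostDistributive.

(** * Standard Young tableaux *)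

Notation cell := (nat * nat)%type.
Notation rightc c := (c.1, c.2.+1).
Notation downc c := (c.1.+1, c.2).
Notation at_ T i := (nth (0%N, 0%N) T i).

Lemma mem_cells la mu (c : cell) : (c \in cells la mu) =
  (c.1 < size la)%N && (nth 0 mu c.1 <= c.2 < nth 0 la c.1)%N.
Proof.
have nE (s : seq nat) i : (s`_i)%R = nth 0 s i by [].
case: c => i j /=; apply/allpairsPdep/idP => [[i' [j' [hi hj [-> ->]]]]|].
  by move: hi hj; rewrite !mem_iota !nE; lia.
by move=> H; exists i, j; split=> //; rewrite mem_iota ?nE; lia.
Qed.

Lemma uniq_cells la mu : uniq (cells la mu).
Proof.
apply: allpairs_uniq_dep => [|i _|p p' _ _ /= []]; rewrite ?iota_uniq //.
by case: p p' => [i j] [i' j'] /= -> ->.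
Qed.

Lemma mem_SYT la mu T : (T \in SYT la mu) = is_SYT la mu T.
Proof.
rewrite mem_filter mem_permutations /is_SYT; case: (perm_eq T _); rewrite ?andbT //.
Qed.

Lemma uniq_SYT la mu : uniq (SYT la mu).
Proof. by apply: filter_uniq; apply: permutations_uniq. Qed.

Lemma SYT_perm la mu T : T \in SYT la mu -> perm_eq T (cells la mu).
Proof. by rewrite mem_SYT => /andP[]. Qed.

Lemma SYT_uniq la mu T : T \in SYT la mu -> uniq T.
Proof. by move/SYT_perm/perm_uniq->; apply: uniq_cells. Qed.

Lemma SYT_size la mu T : T \in SYT la mu -> size T = size (cells la mu).
Proof. by move/SYT_perm/perm_size. Qed.

Lemma SYT_mem la mu T : T \in SYT la mu -> T =i cells la mu.
Proof. by move/SYT_perm/perm_mem. Qed.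

Definition next_to (c d : cell) : bool := (d == rightc c) || (d == downc c).

Lemma SYT_P la mu T : reflect
  (perm_eq T (cells la mu) /\
   forall c d : cell, c \in cells la mu -> d \in cells la mu -> next_to c d ->
     (index c T < index d T)%N)
  (T \in SYT la mu).
Proof.
rewrite mem_SYT; apply: (iffP andP) => [[pT /allP H]|[pT H]]; split=> //.
  move=> c d; rewrite -!(perm_mem pT) => cT dT.
  case/orP=> /eqP e; move: (H c cT) => /andP[/implyP h1 /implyP h2].
    by rewrite e h1 // -e.
  by rewrite e h2 // -e.
apply/allP=> c cT; apply/andP; split; apply/implyP=> dT; apply: H;
  by rewrite -?(perm_mem pT) // /next_to eqxx ?orbT.
Qed.

Lemma SYT_next la mu T (c d : cell) : T \in SYT la mu ->
  c \in cells la mu -> d \in cells la mu -> next_to c d ->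
  (index c T < index d T)%N.
Proof. by case/SYT_P => _; apply. Qed.

Definition tpos (i p : nat) : nat := if p == i then i.+1 else if p == i.+1 then i else p.

Lemma tposK i : involutive (tpos i).
Proof. by move=> p; rewrite /tpos; do !case: eqP => //; lia. Qed.

Definition swap_at (i : nat) (T : seq cell) : seq cell :=
  mkseq (fun p => nth (0, 0) T (tpos i p)) (size T).

Lemma size_swap i T : size (swap_at i T) = size T.
Proof. exact: size_mkseq. Qed.

Lemma tpos_lt i p m : (i.+1 < m)%N -> (tpos i p < m)%N = (p < m)%N.
Proof. by rewrite /tpos; do !case: eqP; lia. Qed.

Lemma nth_swap i T p : (i.+1 < size T)%N ->
  nth (0, 0) (swap_at i T) p = nth (0, 0) T (tpos i p).
Proof.
move=> lti; have [ltp|lep] := ltnP p (size T); first by rewrite nth_mkseq.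
by rewrite !nth_default ?size_swap // leqNgt tpos_lt // -leqNgt.
Qed.

Lemma swap_atK i T : (i.+1 < size T)%N -> swap_at i (swap_at i T) = T.
Proof.
move=> lti; apply: (@eq_from_nth _ (0, 0)) => [|p _]; first by rewrite !size_swap.
by rewrite !nth_swap ?size_swap // tposK.
Qed.

Lemma perm_swap i T : (i.+1 < size T)%N -> perm_eq (swap_at i T) T.
Proof.
move=> lti; rewrite -[X in perm_eq _ X](mkseq_nth (0, 0) T) /swap_at /mkseq.
rewrite (map_comp (nth (0,0) T) (tpos i)) perm_map // uniq_perm ?iota_uniq //.
  by rewrite map_inj_uniq ?iota_uniq //; apply: inv_inj; apply: tposK.
move=> p; rewrite -{1}[p](tposK i) mem_map; last by apply: inv_inj; apply: tposK.
by rewrite !mem_iota /= !add0n tpos_lt.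
Qed.

Lemma index_swap i T (c : cell) : uniq T -> (i.+1 < size T)%N -> c \in T ->
  index c (swap_at i T) = tpos i (index c T).
Proof.
move=> uT lti cT; have uS : uniq (swap_at i T) by rewrite (perm_uniq (perm_swap lti)).
have lt : (tpos i (index c T) < size (swap_at i T))%N.
  by rewrite size_swap tpos_lt // index_mem.
by rewrite -[in LHS](nth_index (0,0) cT) -{1}[index c T](tposK i) -nth_swap // index_uniq.
Qed.

(** Only the two exchanged cells change their relative order, so standardness can fail at that pair
    alone. *)
Lemma SYT_swap la mu T i : T \in SYT la mu -> (i.+1 < size T)%N ->
  (swap_at i T \in SYT la mu) = ~~ next_to (nth (0,0) T i) (nth (0,0) T i.+1).
Proof.
move=> TS lti; have uT := SYT_uniq TS.
have mem p : (p < size T)%N -> nth (0,0) T p \in cells la mu.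
  by move=> ltp; rewrite -(SYT_mem TS) mem_nth.
have lti' : (i < size T)%N by lia.
apply/idP/idP => [sS|nn].
  apply/negP => nx; have := SYT_next sS (mem _ lti') (mem _ lti) nx.
  rewrite !index_swap ?mem_nth // !index_uniq // /tpos eqxx.
  by case: eqP; rewrite ?eqxx; lia.
apply/SYT_P; split; first by apply: perm_trans (perm_swap lti) (SYT_perm TS).
move=> c d cY dY nx; have := SYT_next TS cY dY nx.
rewrite !index_swap ?(SYT_mem TS) //.
have [ec|nc] := eqVneq (index c T) i; have [ed|nd] := eqVneq (index d T) i.+1.
- by case/negP: nn; rewrite -ed -ec !nth_index ?(SYT_mem TS).
- by rewrite /tpos ec eqxx; do !case: eqP; lia.
- by rewrite /tpos ed eqxx; do !case: eqP; lia.
- by rewrite /tpos; do !case: eqP; lia.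
Qed.

Lemma mem_straight la (c : cell) : (c \in cells la [::]) = (c.2 < nth 0 la c.1)%N.
Proof.
rewrite mem_cells nth_nil /=; have [//|le] := ltnP c.1 (size la).
by rewrite nth_default.
Qed.

Lemma partition_nth la i j : is_partition la -> (i <= j)%N -> (nth 0 la j <= nth 0 la i)%N.
Proof.
case/andP=> srt _ leij; have [ltj|lej] := ltnP j (size la); last by rewrite (nth_default _ lej).
apply: (sorted_leq_nth _ _ 0%N srt) => //; rewrite ?inE //; last by lia.
  by move=> a b c; rewrite /geq /=; lia.
by move=> a; rewrite /geq /=; lia.
Qed.

Section Straight.
Variable la : seq nat.
Hypothesis la_part : is_partition la.
Notation Y := (cells la [::]).
Notation X := (SYT la [::]).

Lemma straight_closed (c d : cell) : d \in Y -> (c.1 <= d.1)%N -> (c.2 <= d.2)%N -> c \in Y.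
Proof.
rewrite !mem_straight => dY le1 le2; have := partition_nth la_part le1; lia.
Qed.

Lemma SYT_mono T (c d : cell) : T \in X -> d \in Y -> (c.1 <= d.1)%N -> (c.2 <= d.2)%N ->
  (index c T <= index d T)%N.
Proof.
move=> TX dY; have [m] := ubnP (d.1 - c.1 + (d.2 - c.2)); elim: m c => // m IH c lem le1 le2.
have cY := straight_closed dY le1 le2.
have [lt1|ge1] := ltnP c.1 d.1.
  apply: leq_trans (IH (downc c) _ _ _); rewrite /=; try lia.
  apply/ltnW/(SYT_next TX cY); last by rewrite /next_to eqxx orbT.
  by apply: straight_closed dY _ _.
have [lt2|ge2] := ltnP c.2 d.2.
  apply: leq_trans (IH (rightc c) _ _ _); rewrite /=; try lia.
  apply/ltnW/(SYT_next TX cY); last by rewrite /next_to eqxx.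
  by apply: straight_closed dY _ _.
suff -> : c = d by [].
by case: c d {cY dY lem IH} le1 le2 ge1 ge2 => [a b] [a' b'] /= *; congr pair; lia.
Qed.

Variables (T : seq cell) (i : nat).
Hypothesis TX : T \in X.

Lemma at_mem p : (p < size T)%N -> at_ T p \in Y.
Proof. by move=> lt; rewrite -(SYT_mem TX) mem_nth. Qed.

Lemma at_nle p q : (p < q)%N -> (q < size T)%N ->
  (at_ T q).1 <= (at_ T p).1 -> (at_ T p).2 < (at_ T q).2.
Proof.
move=> ltpq ltq le1; rewrite ltnNge; apply/negP => le2.
have ltp : (p < size T)%N by lia.
have := SYT_mono TX (at_mem ltp) le1 le2.
by rewrite !index_uniq ?(SYT_uniq TX) //; lia.
Qed.

(** If the second cell lies weakly south-east of the first, a neighbour of the first cell on the way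
    to it is filled strictly after the first and no later than the second, hence is the second. *)
Lemma at_consecutive : (i.+1 < size T)%N ->
  [\/ at_ T i.+1 = rightc (at_ T i), at_ T i.+1 = downc (at_ T i),
      (at_ T i).1 < (at_ T i.+1).1 /\ (at_ T i.+1).2 < (at_ T i).2 |
      (at_ T i.+1).1 < (at_ T i).1 /\ (at_ T i).2 < (at_ T i.+1).2].
Proof.
move=> lti; have lti' : (i < size T)%N by lia.
set x := at_ T i; set y := at_ T i.+1.
have xY : x \in Y := at_mem lti'; have yY : y \in Y := at_mem lti.
have ix : index x T = i by rewrite index_uniq ?(SYT_uniq TX).
have iy : index y T = i.+1 by rewrite index_uniq ?(SYT_uniq TX).
have [le1|gt1] := leqP y.1 x.1.
  have lt2 : x.2 < y.2 by apply: at_nle.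
  have [lt1|ge1] := ltnP y.1 x.1; first by constructor 4.
  constructor 1; have rY : rightc x \in Y by apply: straight_closed yY _ _ => //=; lia.
  have l1 : index x T < index (rightc x) T.
    by apply: SYT_next TX _ _ _ => //; rewrite /next_to eqxx.
  have l2 : index (rightc x) T <= index y T by apply: SYT_mono => //=; lia.
  have e : index (rightc x) T = i.+1 by lia.
  by rewrite /y -e nth_index // (SYT_mem TX).
have [lt2|ge2] := ltnP y.2 x.2; first by constructor 3.
constructor 2; have rY : downc x \in Y by apply: straight_closed yY _ _ => //=; lia.
have l1 : index x T < index (downc x) T.
  by apply: SYT_next TX _ _ _ => //; rewrite /next_to eqxx orbT.
have l2 : index (downc x) T <= index y T by apply: SYT_mono => //=; lia.
have e : index (downc x) T = i.+1 by lia.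
by rewrite /y -e nth_index // (SYT_mem TX).
Qed.

(** On a common diagonal, the right and the lower neighbour of the first cell would both have to be
    filled at the single position in between. This keeps the sum of two consecutive gaps nonzero in
    the braid relation. *)
Lemma at_skip : (i.+2 < size T)%N ->
  (at_ T i).2 + (at_ T i.+2).1 != (at_ T i.+2).2 + (at_ T i).1.
Proof.
move=> lti; have lti' : (i < size T)%N by lia.
set x := at_ T i; set z := at_ T i.+2; apply/eqP => e.
have xY : x \in Y := at_mem lti'; have zY : z \in Y := at_mem lti.
have ix : index x T = i by rewrite index_uniq ?(SYT_uniq TX).
have iz : index z T = i.+2 by rewrite index_uniq ?(SYT_uniq TX).
have [le1|gt1] := leqP z.1 x.1.
  by have : x.2 < z.2 by [apply: at_nle => //; lia]; lia.
have aY : rightc x \in Y by apply: straight_closed zY _ _ => //=; lia.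
have bY : downc x \in Y by apply: straight_closed zY _ _ => //=; lia.
have mid (u : cell) : u \in Y -> u.1 <= z.1 -> u.2 <= z.2 -> u != z -> next_to x u -> u = at_ T i.+1.
  move=> uY u1 u2 uz nx; have := SYT_next TX xY uY nx.
  have := SYT_mono TX zY u1 u2; rewrite ix iz => h1 h2.
  have nz : index u T != i.+2.
    by apply: contraNneq uz => e'; rewrite /z -e' nth_index // (SYT_mem TX).
  have <- : index u T = i.+1 by lia.
  by rewrite nth_index // (SYT_mem TX).
have ea : rightc x = at_ T i.+1.
  apply: mid => //=; try lia; last by rewrite /next_to eqxx.
  by apply/eqP => /(congr1 fst) /=; lia.
have eb : downc x = at_ T i.+1.
  apply: mid => //=; try lia; last by rewrite /next_to eqxx orbT.
  by apply/eqP => /(congr1 snd) /=; lia.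
by move: ea; rewrite -eb => -[]; lia.
Qed.

End Straight.

(** * Young's seminormal form *)

Local Open Scope ring_scope.

Definition content (c : cell) : rat := c.2%:R - c.1%:R.
(** The axial distance of Young's seminormal form; its inverse is the diagonal coefficient of the
    reflection. *)
Definition gap i (T : seq cell) : rat := content (at_ T i.+1) - content (at_ T i).

Lemma tpos0 i : tpos i i = i.+1.
Proof. by rewrite /tpos eqxx. Qed.
Lemma tpos1 i : tpos i i.+1 = i.
Proof. by rewrite /tpos eqxx; case: eqP => //; lia. Qed.
Lemma tpos_out i p : p != i -> p != i.+1 -> tpos i p = p.
Proof. by move=> /negbTE h1 /negbTE h2; rewrite /tpos h1 h2. Qed.

Lemma gap_swap i T : (i.+1 < size T)%N -> gap i (swap_at i T) = - gap i T.
Proof. by move=> lti; rewrite /gap !nth_swap // tpos0 tpos1 [RHS]opprB. Qed.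

(* For consecutive cells x, y, z of a tableau: the flags say which of the pairs
   (x,y), (y,z), (x,z) are adjacent, and [p], [q] are the content differences
   from x to y and from y to z. *)
Lemma braid_coordinates (p q g0 g1 g2 g12 g21 g3 : rat) (xy yz xz : bool) :
  p != 0 -> q != 0 -> p + q != 0 ->
  (xy -> p = 1 \/ p = -1) -> (yz -> q = 1 \/ q = -1) ->
  (xz -> p + q = 1 \/ p + q = -1) ->
  (~~ (~~ xy) -> g1 = 0) -> (~~ (~~ yz) -> g2 = 0) ->
  (~~ (~~ xy && ~~ xz) -> g12 = 0) -> (~~ (~~ yz && ~~ xz) -> g21 = 0) ->
  ([|| xy, yz | xz] -> g3 = 0) ->
  ((g0 / p + (1 - p^-1) * g1) / q +
   (1 - q^-1) * (if ~~ yz then g2 / (p + q) + (1 - (p + q)^-1) * g21 else 0)) / p +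
  (1 - p^-1) *
    (if ~~ xy then
       (if ~~ xy then g1 / - p + (1 - (- p)^-1) * g0 else 0) / (p + q) +
       (1 - (p + q)^-1) * (if ~~ xy && ~~ xz then g12 / q + (1 - q^-1) * g3 else 0)
     else 0) =
  ((g0 / q + (1 - q^-1) * g2) / p +
   (1 - p^-1) * (if ~~ xy then g1 / (p + q) + (1 - (p + q)^-1) * g12 else 0)) / q +
  (1 - q^-1) *
    (if ~~ yz then
       (if ~~ yz then g2 / - q + (1 - (- q)^-1) * g0 else 0) / (p + q) +
       (1 - (p + q)^-1) * (if ~~ yz && ~~ xz then g21 / p + (1 - p^-1) * g3 else 0)
     else 0).
Proof.
move=> hp hq hpq.
case: xy; case: yz; case: xz => /= cxy cyz cxz k1 k2 k12 k21 k3.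
- by case: (cxy isT) (cyz isT) (cxz isT) => -> [] -> [] e; exfalso; lra.
- rewrite ?(k1 isT) ?(k2 isT) ?(k12 isT) ?(k21 isT).
  by case: (cxy isT) (cyz isT) hpq => -> [] ->; rewrite ?invrN ?invr1 ?subrr ?addNr ?eqxx //; ring.
- rewrite ?(k1 isT) ?(k12 isT) ?(k21 isT) ?(k3 isT).
  have [{cxy}e|{cxy}e] := cxy isT; rewrite e in hpq cxz *.
    case: (cxz isT) => e'; first by case/eqP: hq; lra.
    have -> : q = -2%:R by lra.
    have -> : 1 + - 2%:R = -1 :> rat by ring.
    by field.
  case: (cxz isT) => e'; last by case/eqP: hq; lra.
  have -> : q = 2%:R by lra.
  have -> : -1 + 2%:R = 1 :> rat by ring.
  by field.
- rewrite ?(k1 isT) ?(k12 isT) ?(k3 isT).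
  by case: (cxy isT) => e; rewrite e in hpq *; field; rewrite ?hq ?hpq.
- rewrite ?(k2 isT) ?(k12 isT) ?(k21 isT) ?(k3 isT).
  have [{cyz}e|{cyz}e] := cyz isT; rewrite e in hpq cxz *.
    case: (cxz isT) => e'; first by case/eqP: hp; lra.
    have -> : p = -2%:R by lra.
    have -> : - 2%:R + 1 = -1 :> rat by ring.
    by field.
  case: (cxz isT) => e'; last by case/eqP: hp; lra.
  have -> : p = 2%:R by lra.
  have -> : 2%:R - 1 = 1 :> rat by ring.
  by field.
- rewrite ?(k2 isT) ?(k21 isT) ?(k3 isT).
  by case: (cyz isT) => e; rewrite e in hpq *; field; rewrite ?hp ?hpq.
- rewrite ?(k12 isT) ?(k21 isT) ?(k3 isT).
  case: (cxz isT) => e; rewrite e.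
    by have eq : q = 1 - p by [lra]; rewrite eq in hq *; field; rewrite hp hq.
  by have eq : q = -1 - p by [lra]; rewrite eq in hq *; field; rewrite hp hq.
- by field; rewrite hp hq hpq.
Qed.

Section Seminormal.
Variable la : seq nat.
Hypothesis la_part : is_partition la.
Notation Y := (cells la [::]).
Notation X := (SYT la [::]).
Notation tab := (seq_sub X).
Notation E := {ffun tab -> rat^o}.

Definition ext (f : E) (s : seq cell) : rat := if insub s is Some t then f t else 0.

Lemma ext_val f (t : tab) : ext f (val t) = f t.
Proof. by rewrite /ext valK. Qed.

Lemma ext_out f s : s \notin X -> ext f s = 0.
Proof. by move=> sX; rewrite /ext insubN. Qed.

(* The swap leaves the tableaux exactly when the two cells are adjacent; then [gap]
   is 1 or -1 and [ext] makes the second term vanish. *)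
Definition seminormal i (f : E) : E :=
  [ffun t => f t / gap i (val t) + (1 - (gap i (val t))^-1) * ext f (swap_at i (val t))].

Lemma ext_seminormal i f s : ext (seminormal i f) s =
  if s \in X then ext f s / gap i s + (1 - (gap i s)^-1) * ext f (swap_at i s) else 0.
Proof.
case: ifP => [sX|/negbT/ext_out//].
have -> : s = val (Sub s sX : tab) by [].
by rewrite !ext_val ffunE.
Qed.

Lemma ext_inj f g : {in X, ext f =1 ext g} -> f = g.
Proof. by move=> H; apply/ffunP=> t; rewrite -!ext_val H // (valP t). Qed.

Lemma next_to_content (x y : cell) : next_to x y ->
  content y - content x = 1 \/ content y - content x = -1.
Proof.
by case/orP=> /eqP ->; [left|right]; rewrite /content /= -natr1; ring.
Qed.

Lemma gap_far T i : T \in X -> (i.+1 < size T)%N -> ~~ next_to (at_ T i) (at_ T i.+1) ->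
  gap i T != 0 /\ gap i T != 1.
Proof.
move=> TX lti; rewrite /next_to /gap /content.
case: (at_consecutive la_part TX lti) => [->|->|[l1 l2] _|[l1 l2] _]; rewrite ?eqxx ?orbT //.
  have h1 : ((at_ T i).1.+1%:R <= (at_ T i.+1).1%:R :> rat) by rewrite ler_nat.
  have h2 : ((at_ T i.+1).2.+1%:R <= (at_ T i).2%:R :> rat) by rewrite ler_nat.
  by move: h1 h2; rewrite -!natr1 => h1 h2; split; apply/eqP; lra.
have h1 : ((at_ T i.+1).1.+1%:R <= (at_ T i).1%:R :> rat) by rewrite ler_nat.
have h2 : ((at_ T i).2.+1%:R <= (at_ T i.+1).2%:R :> rat) by rewrite ler_nat.
by move: h1 h2; rewrite -!natr1 => h1 h2; split; apply/eqP; lra.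
Qed.

Lemma gap_neq0 T i : T \in X -> (i.+1 < size T)%N -> gap i T != 0.
Proof.
move=> TX lti; case: (boolP (next_to (at_ T i) (at_ T i.+1))) => [nx|/(gap_far TX lti)[]//].
by rewrite /gap; case: (next_to_content nx) => ->.
Qed.

Lemma at_order u p q : u \in X -> (p < size u)%N -> (q < size u)%N ->
  next_to (at_ u p) (at_ u q) -> (p < q)%N.
Proof.
move=> uX ltp ltq nx.
have := SYT_next uX (at_mem uX ltp) (at_mem uX ltq) nx.
by rewrite !index_uniq ?(SYT_uniq uX).
Qed.

Lemma seminormal_invol i f : (i.+1 < size Y)%N -> seminormal i (seminormal i f) = f.
Proof.
move=> lti; apply: ext_inj => s sX; have lts : (i.+1 < size s)%N by rewrite (SYT_size sX).
rewrite ext_seminormal sX !ext_seminormal sX swap_atK // gap_swap // SYT_swap //.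
case: (boolP (next_to _ _)) => [nx|/(gap_far sX lts)[n0 n1]] /=.
  rewrite (ext_out f (s := swap_at i s)) ?SYT_swap ?nx //.
  by rewrite /gap; case: (next_to_content nx) => ->; rewrite ?invrN invr1; ring.
by field; rewrite ?oppr_eq0 n0.
Qed.

Lemma swap_comm i j s : (i.+1 < j)%N -> (j.+1 < size s)%N ->
  swap_at i (swap_at j s) = swap_at j (swap_at i s).
Proof.
move=> ltij ltj; have lti : (i.+1 < size s)%N by lia.
apply: (@eq_from_nth _ (0%N, 0%N)) => [|p _]; first by rewrite !size_swap.
rewrite !nth_swap ?size_swap //; congr nth.
by rewrite /tpos; do !case: eqP; lia.
Qed.

Lemma swap_braid i s : (i.+2 < size s)%N ->
  swap_at i (swap_at i.+1 (swap_at i s)) = swap_at i.+1 (swap_at i (swap_at i.+1 s)).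
Proof.
move=> lti; have lti' : (i.+1 < size s)%N by lia.
apply: (@eq_from_nth _ (0%N, 0%N)) => [|p _]; first by rewrite !size_swap.
rewrite !nth_swap ?size_swap //; congr nth.
by rewrite /tpos; do !case: eqP; lia.
Qed.

Lemma gap_swap_far i j s : (i.+1 < j)%N || (j.+1 < i)%N -> (j.+1 < size s)%N ->
  gap i (swap_at j s) = gap i s.
Proof. by move=> d ltj; rewrite /gap !nth_swap // !tpos_out //; lia. Qed.

Lemma seminormal_comm i j f : (i.+1 < j)%N -> (j.+1 < size Y)%N ->
  seminormal i (seminormal j f) = seminormal j (seminormal i f).
Proof.
move=> ltij ltj; apply: ext_inj => s sX.
have ltjs : (j.+1 < size s)%N by rewrite (SYT_size sX).
have ltis : (i.+1 < size s)%N by lia.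
have m1 : (swap_at i s \in X) = ~~ next_to (at_ s i) (at_ s i.+1) by rewrite SYT_swap.
have m2 : (swap_at j s \in X) = ~~ next_to (at_ s j) (at_ s j.+1) by rewrite SYT_swap.
have nj : next_to (at_ (swap_at i s) j) (at_ (swap_at i s) j.+1) =
          next_to (at_ s j) (at_ s j.+1) by rewrite !nth_swap // !tpos_out //; lia.
have ni : next_to (at_ (swap_at j s) i) (at_ (swap_at j s) i.+1) =
          next_to (at_ s i) (at_ s i.+1) by rewrite !nth_swap // !tpos_out //; lia.
rewrite !ext_seminormal sX !gap_swap_far ?ltij ?orbT // (swap_comm ltij ltjs) m1 m2.
have [n1|n1] /= := boolP (next_to (at_ s i) _); have [n2|n2] /= := boolP (next_to (at_ s j) _).
- rewrite (ext_out f (s := swap_at i s)) ?m1 ?n1 // (ext_out f (s := swap_at j s)) ?m2 ?n2 //.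
  by ring.
- have -> : ext f (swap_at j (swap_at i s)) = 0.
    by apply: ext_out; rewrite -swap_comm // SYT_swap ?size_swap ?ni ?m2 ?n1.
  by rewrite (ext_out f (s := swap_at i s)) ?m1 ?n1 //; ring.
- have -> : ext f (swap_at j (swap_at i s)) = 0.
    by apply: ext_out; rewrite SYT_swap ?size_swap ?nj ?m1 ?n2.
  by rewrite (ext_out f (s := swap_at j s)) ?m2 ?n2 //; ring.
- by ring.
Qed.
(** Evaluated at [s], both sides involve [f] only at the six rearrangements of three consecutive
    cells. Those that are not tableaux contribute 0, and what remains is the rational identity
    [braid_coordinates]. *)
Lemma seminormal_braid i f : (i.+2 < size Y)%N ->
  seminormal i (seminormal i.+1 (seminormal i f)) = seminormal i.+1 (seminormal i (seminormal i.+1 f)).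
Proof.
move=> lti; apply: ext_inj => s sX.
have lt2 : (i.+2 < size s)%N by rewrite (SYT_size sX).
have lt1 : (i.+1 < size s)%N by lia.
have lt0 : (i < size s)%N by lia.
pose x := at_ s i; pose y := at_ s i.+1; pose z := at_ s i.+2.
pose s1 := swap_at i s; pose s2 := swap_at i.+1 s.
pose s12 := swap_at i.+1 s1; pose s21 := swap_at i s2; pose s3 := swap_at i s12.
have sz : [/\ size s1 = size s, size s2 = size s, size s12 = size s,
              size s21 = size s & size s3 = size s] by rewrite !size_swap.
case: sz => z1 z2 z12 z21 z3.
have s3E : swap_at i.+1 s21 = s3 by rewrite /s3 /s12 /s21 /s1 /s2 swap_braid.
have tp2 : tpos i i.+2 = i.+2 by rewrite tpos_out //; lia.
have tp0 : tpos i.+1 i = i by rewrite tpos_out //; lia.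
have a1 : [/\ at_ s1 i = y, at_ s1 i.+1 = x & at_ s1 i.+2 = z].
  by rewrite !nth_swap ?size_swap // !(tpos0, tpos1, tp0, tp2).
have a2 : [/\ at_ s2 i = x, at_ s2 i.+1 = z & at_ s2 i.+2 = y].
  by rewrite !nth_swap ?size_swap // !(tpos0, tpos1, tp0, tp2).
case: a1 a2 => p1 q1 r1 [p2 q2 r2].
have a12 : [/\ at_ s12 i = y, at_ s12 i.+1 = z & at_ s12 i.+2 = x].
  by rewrite !nth_swap ?size_swap // !(tpos0, tpos1, tp0, tp2).
have a21 : [/\ at_ s21 i = z, at_ s21 i.+1 = x & at_ s21 i.+2 = y].
  by rewrite !nth_swap ?size_swap // !(tpos0, tpos1, tp0, tp2).
case: a12 a21 => p12 q12 r12 [p21 q21 r21].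
have a3 : [/\ at_ s3 i = z, at_ s3 i.+1 = y & at_ s3 i.+2 = x].
  by rewrite !nth_swap ?size_swap // !(tpos0, tpos1, tp0, tp2).
case: a3 => p3 q3 r3.
have m1 : (s1 \in X) = ~~ next_to x y by rewrite SYT_swap.
have m2 : (s2 \in X) = ~~ next_to y z by rewrite SYT_swap.
have no u p q : size u = size s -> (p <= q < size s)%N -> next_to (at_ u q) (at_ u p) -> u \notin X.
  move=> su lt nx; apply/negP => uX.
  by have := @at_order u q p uX; rewrite su => /(_ _ _ nx); lia.
have m12 : (s12 \in X) = ~~ next_to x y && ~~ next_to x z.
  have [nx|nx] /= := boolP (next_to x y).
    by apply/negbTE; apply: (@no _ i i.+2); rewrite ?p12 ?r12 //; lia.
  by rewrite SYT_swap ?z1 ?q1 ?r1 // m1 nx.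
have m21 : (s21 \in X) = ~~ next_to y z && ~~ next_to x z.
  have [nx|nx] /= := boolP (next_to y z).
    by apply/negbTE; apply: (@no _ i i.+2); rewrite ?p21 ?r21 //; lia.
  by rewrite SYT_swap ?z2 ?p2 ?q2 // m2 nx.
have m3 : [|| next_to x y, next_to y z | next_to x z] -> ext f s3 = 0.
  move=> h; apply: ext_out; case/or3P: h => nx.
  - by apply: (@no _ i.+1 i.+2); rewrite ?q3 ?r3 //; lia.
  - by apply: (@no _ i i.+1); rewrite ?p3 ?q3 //; lia.
  - by apply: (@no _ i i.+2); rewrite ?p3 ?r3 //; lia.
have g0 : gap i s != 0 by apply: gap_neq0.
have g0' : gap i.+1 s != 0 by apply: gap_neq0.
have ac : content z - content x != 0.
  rewrite subr_eq0 /content; apply/eqP => e.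
  have := at_skip la_part sX lt2; rewrite -/x -/z => /eqP; apply.
  apply/eqP; rewrite -(eqr_nat rat) !natrD; apply/eqP.
  by move: e => /eqP; rewrite subr_eq => /eqP e; rewrite e; ring.
pose p := gap i s; pose q := gap i.+1 s.
have pqE : content z - content x = p + q.
  by rewrite /p /q /gap -/x -/y -/z; ring.
have E1 : gap i s1 = - p by rewrite gap_swap.
have E1' : gap i.+1 s1 = p + q by rewrite -pqE /gap r1 q1.
have E2 : gap i s2 = p + q by rewrite -pqE /gap p2 q2.
have E2' : gap i.+1 s2 = - q by rewrite gap_swap.
have E12 : gap i s12 = q by rewrite /gap p12 q12.
have E21 : gap i.+1 s21 = p by rewrite /gap q21 r21.
have w1 : swap_at i s1 = s by rewrite /s1 swap_atK.
have w2 : swap_at i.+1 s2 = s by rewrite /s2 swap_atK.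
rewrite !(ext_seminormal, sX) -/s1 -/s2 !(m1, m2, E1, E1', E2, E2', w1, w2).
rewrite -/s12 -/s21 !(m12, m21, E12, E21, s3E) -/s3 -/p -/q.
apply: braid_coordinates => //; rewrite -?m12 -?m21 -?m1 -?m2 -?pqE //;
  by [exact: next_to_content | exact: ext_out].
Qed.
End Seminormal.

(** * The Coxeter element *)

Section BraidRotation.
Variables (V : Type) (sg : nat -> V -> V) (m : nat).
Hypothesis sg_invol : forall i f, (i < m)%N -> sg i (sg i f) = f.
Hypothesis sg_comm : forall i j f, (i.+1 < j)%N -> (j < m)%N ->
  sg i (sg j f) = sg j (sg i f).
Hypothesis sg_braid : forall i f, (i.+1 < m)%N ->
  sg i (sg i.+1 (sg i f)) = sg i.+1 (sg i (sg i.+1 f)).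

(** The Coxeter element: the product of all generators in increasing order, the last one applied
    first. *)
Definition rho (f : V) : V := foldr sg f (iota 0 m).
Definition rho_inv (f : V) : V := foldr sg f (rev (iota 0 m)).

Lemma rho_invK : cancel rho_inv rho.
Proof.
move=> f; rewrite /rho /rho_inv.
have: all (fun i => i < m)%N (iota 0 m) by apply/allP=> i; rewrite mem_iota.
elim: (iota 0 m) f => //= i s IH f /andP[lti alls].
by rewrite rev_cons -cats1 foldr_cat IH //= sg_invol.
Qed.

Lemma rhoK : cancel rho rho_inv.
Proof.
move=> f; rewrite /rho /rho_inv.
have: all (fun i => i < m)%N (iota 0 m) by apply/allP=> i; rewrite mem_iota.
elim: (iota 0 m) f => //= i s IH f /andP[lti alls].
by rewrite rev_cons -cats1 foldr_cat /= sg_invol // IH.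
Qed.

Lemma sg_far i a k f : (i < m)%N -> (a + k <= m)%N -> (i.+1 < a)%N || (a + k < i)%N ->
  foldr sg (sg i f) (iota a k) = sg i (foldr sg f (iota a k)).
Proof.
move=> lti; elim: k a => //= k IH a le far; rewrite IH; try lia.
have [lt|ge] := ltnP i.+1 a; first by rewrite (@sg_comm i a) //; lia.
by rewrite (@sg_comm a i) //; lia.
Qed.

(** The generators beyond [i.+1] commute with [sg i], one braid move at [i] turns it into [sg i.+1],
    and this commutes with the generators before [i]. *)
Lemma rho_shift i f : (i.+1 < m)%N -> rho (sg i f) = sg i.+1 (rho f).
Proof.
move=> lti; rewrite /rho.
have -> : iota 0 m = iota 0 i ++ i :: i.+1 :: iota i.+2 (m - i.+2).
  by rewrite -[i :: _]/(iota i (m - i.+2).+2) -{2}[i]add0n -iotaD; congr iota; lia.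
rewrite !foldr_cat /= (@sg_far i i.+2 (m - i.+2)); try lia.
by rewrite sg_braid // (@sg_far i.+1 0 i) //; lia.
Qed.

Lemma rho_shifts a k f : (a + k < m)%N ->
  rho (foldr sg f (iota a k)) = foldr sg (rho f) (iota a.+1 k).
Proof.
by elim: k a => //= k IH a lt; rewrite rho_shift ?IH //; lia.
Qed.

(** The factor [sg m.-1] cancels the end of the inner product; the outer [rho] shifts the remaining
    run by one, which leaves a Coxeter element lacking its leading [sg 0]. Two rotations are
    therefore needed to close the cycle, and the space met in between is the additional one. *)
Lemma rho_wrap f : (0 < m)%N -> rho (rho (sg m.-1 f)) = sg 0 (rho (rho f)).
Proof.
move=> m0; have -> : rho (sg m.-1 f) = foldr sg f (iota 0 m.-1).
  rewrite /rho; have -> : iota 0 m = iota 0 m.-1 ++ [:: m.-1].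
    by rewrite -[[:: m.-1]]/(iota (0 + m.-1) 1) -iotaD; congr iota; lia.
  by rewrite foldr_cat /= sg_invol //; lia.
rewrite rho_shifts; last by lia.
have -> : rho (rho f) = sg 0 (foldr sg (rho f) (iota 1 m.-1)).
  by rewrite {1}/rho -{1}(prednK m0).
by rewrite sg_invol.
Qed.

End BraidRotation.

(** Reading words as numbers in base [B] turns the lexicographic order on words of equal length with
    letters below [B] into an order on naturals, suited to induction and to maxima. *)
Definition code B (s : seq nat) : nat := foldl (fun a x => a * B + x)%N 0%N s.

Lemma foldl_code_lt B (s t : seq nat) a a' : (a < a')%N -> size s = size t ->
  all (fun x => x < B)%N s ->
  (foldl (fun a x => a * B + x)%N a s < foldl (fun a x => a * B + x)%N a' t)%N.
Proof.
elim: s t a a' => [|x s IH] [|y t] //= a a' lt [sz] /andP[xB sB].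
by apply: IH => //; nia.
Qed.

Lemma code_lt B (s t : seq nat) p : size s = size t -> (p < size s)%N ->
  all (fun x => x < B)%N s -> take p s = take p t -> (nth 0 s p < nth 0 t p)%N ->
  (code B s < code B t)%N.
Proof.
move=> sz ltp sB e lt; rewrite /code -(cat_take_drop p s) -(cat_take_drop p t) !foldl_cat e.
rewrite (drop_nth 0%N ltp) (drop_nth 0%N (s := t)) -?sz //=.
apply: foldl_code_lt; rewrite ?size_drop ?sz ?ltn_add2l //.
by apply/allP=> x /mem_drop xs; apply: (allP sB).
Qed.

(** * A basis adapted to descents *)

Definition des_at (T : seq cell) (d : nat) : bool :=
  (d.+1 < size T)%N && ((at_ T d).1 < (at_ T d.+1).1)%N.

(** The descents of [t] cut its entries into blocks. In each block [u] must use the same cells as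
    [t], in any order. *)
Definition agree (t u : seq cell) : bool :=
  all (fun d => des_at t d ==> perm_eq (take d.+1 u) (take d.+1 t)) (iota 0 (size t)).

Lemma agreeP t u : reflect
  (forall d, des_at t d -> perm_eq (take d.+1 u) (take d.+1 t)) (agree t u).
Proof.
apply: (iffP allP) => H d; last by move=> _; apply/implyP; apply: H.
move=> dd; apply: (implyP (H d _)) => //; rewrite mem_iota add0n /=.
by case/andP: dd; lia.
Qed.

Lemma agree_refl t : agree t t.
Proof. by apply/agreeP. Qed.

Lemma no_des_rows t j k : (j <= k)%N -> (k < size t)%N ->
  (forall d, (j <= d < k)%N -> ~~ des_at t d) -> ((at_ t k).1 <= (at_ t j).1)%N.
Proof.
elim: k => [|k IH] lejk ltk nd; first by rewrite (_ : j = 0%N) //; lia.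
have [e|ne] := eqVneq j k.+1; first by rewrite e.
have /IH H : (j <= k)%N by lia.
apply: leq_trans (H _ _); [|lia|by move=> d dl; apply: nd; lia].
have : ~~ des_at t k by apply: nd; lia.
by rewrite /des_at ltk /= -leqNgt.
Qed.

Lemma take_swap_perm i k u : (i.+1 < size u)%N -> k != i.+1 ->
  perm_eq (take k (swap_at i u)) (take k u).
Proof.
move=> lti ki; have [lek|gtk] := leqP k i.
  suff -> : take k (swap_at i u) = take k u by [].
  apply: (@eq_from_nth _ (0%N, 0%N)) => [|p]; first by rewrite !size_take size_swap.
  rewrite size_take size_swap => ltp; have ltpk : (p < k)%N by move: ltp; case: ifP; lia.
  by rewrite !nth_take // nth_swap // tpos_out //; lia.
have [lek|gek] := leqP (size u) k; first by rewrite !take_oversize ?size_swap // perm_swap.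
suff -> : take k (swap_at i u) = swap_at i (take k u).
  by apply: perm_swap; rewrite size_take gek; lia.
apply: (@eq_from_nth _ (0%N, 0%N)) => [|p].
  by rewrite size_swap !size_take size_swap.
rewrite size_take size_swap gek => ltp.
rewrite nth_take // nth_swap // nth_swap; last by rewrite size_take gek; lia.
by rewrite nth_take // tpos_lt //; lia.
Qed.

Lemma agree_swap i t u : (i.+1 < size u)%N -> ~~ des_at t i -> agree t u -> agree t (swap_at i u).
Proof.
move=> lti nd /agreeP H; apply/agreeP => d dd.
apply: perm_trans (H d dd); apply: take_swap_perm => //.
by apply: contraNneq nd => -[<-].
Qed.

Section AdaptedBasis.
Variable la : seq nat.
Hypothesis la_part : is_partition la.
Notation Y := (cells la [::]).
Notation X := (SYT la [::]).
Notation tab := (seq_sub X).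
Notation E := {ffun tab -> rat^o}.

(** The two cells lie in one block of [t], along which the row index of [t] never grows. A cell and
    the one below it, which [t] fills later, cannot share such a block. *)
Lemma agree_not_down i t u : t \in X -> u \in X -> (i.+1 < size u)%N ->
  ~~ des_at t i -> agree t u -> at_ u i.+1 != downc (at_ u i).
Proof.
move=> tX uX lti nd /agreeP H; apply/eqP => e.
have lti' : (i < size u)%N by lia.
set x := at_ u i in e; set y := at_ u i.+1 in e.
have xu : x \in u by rewrite mem_nth. 
have yu : y \in u by rewrite mem_nth.
have xt : x \in t by rewrite (SYT_mem tX) -(SYT_mem uX).
have yt : y \in t by rewrite (SYT_mem tX) -(SYT_mem uX).
have lt : (index x t < index y t)%N.
  apply: (SYT_next tX); rewrite -?(SYT_mem tX) //.
  by rewrite /next_to -e eqxx orbT.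
have [/hasP|nodes] := boolP (has (des_at t) (iota (index x t) (index y t - index x t))).
  case=> d; rewrite mem_iota => ld dd.
  have := perm_mem (H d dd).
  move=> pm; have := pm x; have := pm y; rewrite !in_take //.
  rewrite !index_uniq ?(SYT_uniq uX) // => e1 e2.
  by have ed : d = i; [lia | rewrite ed in dd; rewrite dd in nd].
have : ((at_ t (index y t)).1 <= (at_ t (index x t)).1)%N.
  apply: no_des_rows; rewrite ?index_mem //; first by apply: ltnW.
  by move=> d dl; apply: (hasPn nodes); rewrite mem_iota; lia.
by rewrite !nth_index // e /= ltnn.
Qed.

(** At the first difference, the cell used by [u] occurs later in the same block of [t], hence in a
    row with no larger index. Equal rows are impossible: each of the two cells would be left of the
    other, by standardness of [t] and of [u]. *)
Lemma agree_triangular t u : t \in X -> u \in X -> agree t u -> u != t ->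
  (code (size la) (map fst u) < code (size la) (map fst t))%N.
Proof.
move=> tX uX /agreeP H ne.
have sut : size u = size t by rewrite (SYT_size uX) (SYT_size tX).
have ex : exists p, (p < size t)%N && (at_ u p != at_ t p).
  have /hasP[p] : has (fun p => at_ u p != at_ t p) (iota 0 (size t)).
    apply: contraNT ne => /hasPn h; apply/eqP.
    apply: (@eq_from_nth _ (0%N, 0%N)) => // p ltp; apply/eqP.
    by have := h p; rewrite mem_iota -sut ltp => /(_ isT) /negPn.
  by rewrite mem_iota => lp np; exists p; rewrite np andbT; lia.
case: (ex_minnP ex) => p /andP[ltp np] min.
have eqp q : (q < p)%N -> at_ u q = at_ t q.
  move=> ltq; apply/eqP; apply: contraT => nq.
  by have := min q; rewrite nq andbT; lia.
have tk : take p u = take p t.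
  apply: (@eq_from_nth _ (0%N, 0%N)) => [|q]; first by rewrite !size_take sut.
  by rewrite size_take sut ltp => ltq; rewrite !nth_take ?eqp.
have ltpu : (p < size u)%N by rewrite sut.
have later s s' : uniq s -> uniq s' -> size s = size s' -> (p < size s)%N ->
    take p s = take p s' -> at_ s p != at_ s' p -> s =i s' ->
    (p < index (at_ s p) s')%N.
  move=> us us' ss lps tks ns mm.
  have ys' : at_ s p \in s' by rewrite -mm mem_nth.
  have : at_ s p \notin take p s'.
    by rewrite -tks in_take ?mem_nth // index_uniq // ltnn.
  rewrite in_take // -leqNgt leq_eqVlt => /orP[/eqP e|//].
  by case/eqP: ns; rewrite [in RHS]e nth_index.
have uu := SYT_uniq uX; have ut := SYT_uniq tX.
have mut : u =i t by move=> c; rewrite (SYT_mem uX) (SYT_mem tX).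
set y := at_ u p; set x := at_ t p.
have yt : y \in t by rewrite -mut mem_nth.
have xu : x \in u by rewrite mut mem_nth.
have lty : (p < index y t)%N by apply: later.
have ltx : (p < index x u)%N by apply: later => //; rewrite eq_sym.
have rows : (y.1 <= x.1)%N.
  rewrite -[y](nth_index (0%N, 0%N) yt); apply: no_des_rows; rewrite ?index_mem //; first lia.
  move=> d ld; apply/negP => dd; have := perm_mem (H d dd) y.
  by rewrite !in_take ?mem_nth // index_uniq //; lia.
apply: (@code_lt _ _ _ p); rewrite ?size_map //; last first.
- rewrite !(nth_map (0%N, 0%N)) //.
  rewrite ltn_neqAle rows andbT; apply/negP => /eqP e.
  have h1 : (x.2 < y.2)%N.
    have := @at_nle la la_part t tX p (index y t) lty.
    by rewrite index_mem yt nth_index //= -/x e; apply.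
  have h2 : (y.2 < x.2)%N.
    have := @at_nle la la_part u uX p (index x u) ltx.
    by rewrite index_mem xu nth_index //= -/y e; apply.
  by lia.
- by rewrite -!map_take tk.
- apply/allP=> r /mapP[c cu ->].
  by have := SYT_mem uX c; rewrite cu mem_cells => /esym/andP[].
Qed.
End AdaptedBasis.

Lemma seminormal_linear la i : linear (@seminormal la i).
Proof.
have extD (k : rat) (f g : {ffun seq_sub (SYT la [::]) -> rat^o}) s :
    ext (k *: f + g) s = k * ext f s + ext g s.
  by rewrite /ext; case: insubP => [t _ _|_]; rewrite ?ffunE ?mulr0 ?addr0.
move=> k f g; apply/ffunP=> t; rewrite !ffunE extD /GRing.scale /=; ring.
Qed.
HB.instance Definition _ la i :=
  GRing.isLinear.Build rat _ _ _ (@seminormal la i) (@seminormal_linear la i).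

Lemma rho_linear la m : linear (rho (@seminormal la) m).
Proof.
move=> k f g; rewrite /rho; elim: (iota 0 m) => //= i s ->.
by rewrite linearP.
Qed.
HB.instance Definition _ la m :=
  GRing.isLinear.Build rat _ _ _ (rho (@seminormal la) m) (@rho_linear la m).

Section Fixed.
Variable la : seq nat.
Hypothesis la_part : is_partition la.
Notation Y := (cells la [::]).
Notation X := (SYT la [::]).
Notation tab := (seq_sub X).
Notation E := {ffun tab -> rat^o}.

Definition fixv i : {vspace E} := fixedSpace (linfun (@seminormal la i)).

Lemma fixvP i (f : E) : reflect (seminormal i f = f) (f \in fixv i).
Proof. by apply: (iffP fixedSpaceP); rewrite lfunE. Qed.

(** In this normalisation a function is fixed by the i-th reflection exactly when it takes equal
    values at a tableau and its swap and vanishes where the two cells are vertically adjacent.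
    Indicator functions of suitable sets of tableaux are therefore fixed. *)
Definition bvec (t : tab) : E := [ffun u => (agree (val t) (val u))%:R].

Definition row_code (t : tab) : nat := code (size la) (map fst (val t)).

Lemma bvec_tri t u : bvec t u != 0 -> u = t \/ (row_code u < row_code t)%N.
Proof.
rewrite ffunE pnatr_eq0 eqb0 negbK => ag.
have [->|ne] := eqVneq u t; [by left | right].
by apply: agree_triangular => //; rewrite ?(valP t) ?(valP u) // (inj_eq val_inj).
Qed.

Lemma bvec_diag t : bvec t t = 1.
Proof. by rewrite ffunE agree_refl. Qed.

Lemma size_tab (t : tab) : size (val t) = size Y.
Proof. exact: SYT_size (valP t). Qed.

Lemma row_code_swap (t u : tab) i : des_at (val t) i -> val u = swap_at i (val t) ->
  (row_code t < row_code u)%N.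
Proof.
case/andP=> lti dd; rewrite /row_code => ->.
have lti' : (i < size (val t))%N by apply: ltnW.
apply: (@code_lt _ _ _ i); rewrite ?size_map ?size_iota ?size_swap //.
- apply/allP=> r /mapP[c cu ->].
  by have := SYT_mem (valP t) c; rewrite cu mem_cells => /esym/andP[].
- rewrite -[LHS]map_take -[RHS]map_take; congr (map fst _); apply: (@eq_from_nth _ (0%N, 0%N)) => [|p].
    by rewrite !size_take size_swap.
  rewrite size_take lti' => lp.
  by rewrite !nth_take // nth_swap // tpos_out //; move: lp; clear; lia.
- by rewrite !(nth_map (0%N, 0%N)) ?size_swap // nth_swap // tpos0.
Qed.

Lemma bvec_fix t i : (i.+1 < size Y)%N -> ~~ des_at (val t) i -> bvec t \in fixv i.
Proof.
move=> lti nd; apply/fixvP/ffunP=> u; rewrite ffunE.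
have ltu : (i.+1 < size (val u))%N by rewrite size_tab.
have uX := valP u; have tX := valP t.
case: (boolP (swap_at i (val u) \in X)) => [sX|nsX].
  have -> : ext (bvec t) (swap_at i (val u)) = bvec t u.
    rewrite -[swap_at i (val u)]/(val (SeqSub sX : tab)) ext_val !ffunE /=.
    congr (_ %:R); congr nat_of_bool; apply/idP/idP; last exact: agree_swap.
    by move/(agree_swap (i := i)); rewrite size_swap swap_atK //; apply.
  by have := gap_neq0 la_part uX ltu => g0; field.
rewrite ext_out // mulr0 addr0; move: nsX; rewrite SYT_swap // negbK.
case/orP=> /eqP e.
  have -> : gap i (val u) = 1 by rewrite /gap e /content /= -natr1; ring.
  by rewrite divr1.
have -> : bvec t u = 0; last by rewrite mul0r.
rewrite ffunE; case ag : (agree _ _) => //.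
by have := agree_not_down la_part tX uX ltu nd ag; rewrite e eqxx.
Qed.

(** If the swap is standard, the gap is not 1 and the equation forces equality. If not, a descent
    means vertically adjacent cells, the gap is -1, and both sides are 0. *)
Lemma fix_descent (f : E) i (t : tab) : (i.+1 < size Y)%N -> f \in fixv i ->
  des_at (val t) i ->
  f t = ext f (swap_at i (val t)).
Proof.
move=> lti /fixvP fE dd.
have ltt : (i.+1 < size (val t))%N by rewrite size_tab.
have tX := valP t; have := congr1 (fun h : E => h t) fE; rewrite ffunE.
case: (boolP (swap_at i (val t) \in X)) => [sX|nsX] e.
  move: sX; rewrite SYT_swap // => /(gap_far la_part tX ltt) [g0 g1].
  have : (1 - (gap i (val t))^-1) * (f t - ext f (swap_at i (val t))) = 0.
    by apply: etrans (subrr (f t)); rewrite -{3}e; ring.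
  move/eqP; rewrite mulf_eq0 !subr_eq0 eq_sym invr_eq1 (negbTE g1) /=.
  by move/eqP.
rewrite ext_out // in e *; move: nsX; rewrite SYT_swap // negbK.
case/orP=> /eqP e'; first by move: dd; rewrite /des_at e' ltnn andbF.
have g : gap i (val t) = -1 by rewrite /gap e' /content /= -natr1; ring.
by move: e; rewrite g invrN invr1; lra.
Qed.

Lemma ffun_deltaE (f : E) : f = \sum_(t : tab) f t *: [ffun u => (u == t)%:R : rat^o].
Proof.
apply/ffunP=> u; rewrite sum_ffunE (bigD1 u) //= big1 => [|t tu]; rewrite !ffunE.
  by rewrite eqxx addr0 /GRing.scale /= mulr1.
by rewrite eq_sym (negbTE tu) scaler0.
Qed.

(** The family is unitriangular for [row_code], so the delta functions are recovered by induction on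
    it. *)
Lemma bvec_span : span_of bvec setT = fullv.
Proof.
have dl (t : tab) : ([ffun u => (u == t)%:R : rat^o] : E) \in span_of bvec setT.
  have [m] := ubnP (row_code t); elim: m t => // m IH t ltm.
  have bt : bvec t \in span_of bvec setT.
    by apply: (subvP (sumv_sup t _ (subvv _))); rewrite ?inE ?memv_line.
  have := ffun_deltaE (bvec t); rewrite (bigD1 t) //= bvec_diag scale1r => /eqP.
  rewrite -subr_eq => /eqP <-; apply: memvB => //; apply: memv_suml => u ut.
  have [->|nz] := eqVneq (bvec t u) 0; first by rewrite scale0r mem0v.
  case: (bvec_tri nz) => [e|lt]; first by rewrite e eqxx in ut.
  by apply: memvZ; apply: IH; apply: leq_trans lt _.
apply/eqP; rewrite eqEsubv subvf /=; apply/subvP=> f _.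
by rewrite (ffun_deltaE f); apply: memv_suml => t _; apply: memvZ.
Qed.

Lemma dim_ffun_tab : \dim {:E} = #|{: tab}|.
Proof. by rewrite dimvf /dim /= muln1. Qed.

Lemma fixvE i : (i.+1 < size Y)%N ->
  fixv i = span_of bvec [set t | ~~ des_at (val t) i].
Proof.
move=> lti; apply/eqP; rewrite eqEsubv andbC; apply/andP; split.
  by apply/subv_sumP=> t; rewrite inE => nd; rewrite -memvE bvec_fix.
apply/subvP=> f ff.
have : f \in span_of bvec setT by rewrite bvec_span memvf.
case/memv_sumP=> vs vsP fE.
have /fin_all_exists [a aP] t : exists k : rat, vs t = k *: bvec t.
  by have /vlineP := vsP t (in_setT t).
pose D := [set t : tab | des_at (val t) i].
pose g := \sum_(t in D) a t *: bvec t.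
have h : \sum_(t in ~: D) a t *: bvec t \in span_of bvec [set t | ~~ des_at (val t) i].
  apply: memv_suml => t; rewrite !inE => nd; apply: memvZ.
  by apply: (subvP (sumv_sup t _ (subvv _))); rewrite ?inE ?memv_line.
have fgE : f = g + \sum_(t in ~: D) a t *: bvec t.
  rewrite fE (bigID (mem D)) /=; congr (_ + _).
    by apply: eq_big => t //; rewrite in_setT.
  by apply: eq_big => t; rewrite ?in_setT ?in_setC.
suff g0 : forall t, t \in D -> a t = 0.
  by rewrite fgE /g big1 ?add0r // => t /g0 ->; rewrite scale0r.
have gfix : g \in fixv i.
  rewrite (_ : g = f - \sum_(t in ~: D) a t *: bvec t); last by rewrite fgE addrK.
  apply: memvB => //; apply: memv_suml => t; rewrite !inE => nd.
  by apply: memvZ; apply: bvec_fix.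
(* The coefficient of the largest tableau (for the lexicographic order of row words)
   of the descent part is read off both at t0 and at its image under the swap. *)
move=> t1 t1D; apply/eqP/negPn/negP => a1.
pose Q := [pred t | (t \in D) && (a t != 0)].
have Qt1 : Q t1 by rewrite /= t1D.
case: (@arg_maxnP _ t1 Q row_code Qt1) => t0 /andP[t0D a0] mx.
have val_at (u : tab) : (row_code t0 <= row_code u)%N ->
    g u = if u \in D then a u else 0.
  move=> le; rewrite sum_ffunE.
  have z t : t \in D -> t != u -> (a t *: bvec t) u = 0.
    move=> tD tu; rewrite ffunE.
    have [->|at0] := eqVneq (a t) 0; first by rewrite scale0r.
    have [->|nz] := eqVneq (bvec t u) 0; first by rewrite scaler0.
    case: (bvec_tri nz) => [e|lt]; first by rewrite e eqxx in tu.
    by have := mx t; rewrite /= tD at0 => /(_ isT) /(leq_trans lt); rewrite ltnNge le.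
  case: ifP => uD.
    rewrite (bigD1 u) //= big1 => [|t /andP[tD tu]]; last exact: z.
    by rewrite addr0 ffunE bvec_diag /GRing.scale /= mulr1.
  by rewrite big1 // => t tD; apply: z => //; apply: contraFneq uD => <-.
have d0 : des_at (val t0) i by rewrite inE in t0D.
have g0 : g t0 = a t0 by rewrite val_at // t0D.
have e0 := fix_descent lti gfix d0.
have lt0 : (i.+1 < size (val t0))%N by rewrite size_tab.
case: (boolP (swap_at i (val t0) \in X)) => [sX|nsX]; last first.
  by move: e0; rewrite ext_out // g0 => z; rewrite z eqxx in a0.
pose u : tab := SeqSub sX.
have ltu : (row_code t0 < row_code u)%N by apply: (row_code_swap d0).
have uD : u \notin D.
  rewrite inE /des_at /= size_swap !nth_swap // tpos0 tpos1 lt0 /=.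
  by case/andP: d0 => _ /ltnW; rewrite -leqNgt.
move: e0; rewrite -[swap_at i (val t0)]/(val u) ext_val g0 val_at; last exact: ltnW.
by rewrite (negbTE uD) => z; rewrite z eqxx in a0.
Qed.
End Fixed.

(** * Iterated rotation of subsets *)

Section Shift.
Variable n : nat.
Implicit Types (i : 'I_n) (J S : {set 'I_n}).

Lemma val_iter_ordS p i : val (iter p (@ordS n) i) = ((i + p) %% n)%N.
Proof.
elim: p => [|p IH]; first by rewrite addn0 modn_small.
by rewrite iterS /= IH -addn1 modnDml addn1 addnS.
Qed.

Lemma mem_iter_shift1 p i S : (iter p (@ordS n) i \in iter p (@shift1 n) S) = (i \in S).
Proof.
elim: p => //= p IH; rewrite /shift1 mem_imset; last exact: ordS_inj.
exact: IH.
Qed.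

Lemma iter_shift1_eq p S S' : (iter p (@shift1 n) S == iter p (@shift1 n) S') = (S == S').
Proof.
apply/eqP/eqP => [e|->//]; apply/setP=> i.
by rewrite -(mem_iter_shift1 p) e mem_iter_shift1.
Qed.

Lemma iter_shift1_id S : iter n (@shift1 n) S = S.
Proof.
apply/setP=> i; have e : iter n (@ordS n) i = i.
  by apply: val_inj; rewrite val_iter_ordS modnDr modn_small.
by rewrite -{1}e mem_iter_shift1.
Qed.

Lemma card_shift1 S : #|shift1 S| = #|S|.
Proof. by rewrite card_imset //; apply: ordS_inj. Qed.

Lemma shift1U1 i S : shift1 (i |: S) = ordS i |: shift1 S.
Proof. exact: imsetU1. Qed.

Lemma mem_shift1 i S : (ordS i \in shift1 S) = (i \in S).
Proof. by rewrite mem_imset //; apply: ordS_inj. Qed.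

Lemma shift1C S : shift1 (~: S) = ~: shift1 S.
Proof.
apply/setP=> i; rewrite -(ord_predK i) inE !mem_shift1 inE //.
Qed.
End Shift.

(** * Tableaux of non-hook shape have no initial segment as descent or ascent set *)

Section NoPrefix.
Variable la : seq nat.
Hypothesis la_part : is_partition la.
Hypothesis has11 : (1, 1)%N \in cells la [::].
Notation X := (SYT la [::]).
Variable T : seq cell.
Hypothesis TX : T \in X.

Lemma straight11 : [/\ (0, 0)%N \in cells la [::], (0, 1)%N \in cells la [::] & (1, 0)%N \in cells la [::]].
Proof. by split; apply: (straight_closed la_part has11). Qed.

Lemma at0 : at_ T 0 = (0, 0)%N.
Proof.
have [h _ _] := straight11; rewrite -(SYT_mem TX) in h.
have lt : (0 < size T)%N by case: T h.
have i0 : index (0, 0)%N T = 0%N; last by rewrite -[X in nth _ _ X = _]i0 nth_index.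
have := @SYT_mono la la_part T (0, 0)%N _ TX (at_mem TX lt) (leq0n _) (leq0n _).
by rewrite index_uniq ?(SYT_uniq TX) // leqn0 => /eqP.
Qed.

(** Rows strictly increase up to position [p], so (0, 1) comes after [p]; from there on rows never
    increase, and (1, 1), which comes later, cannot lie below (0, 1). *)
Lemma des_not_prefix p : ~ (forall i, (i.+1 < size T)%N -> des_at T i = (i < p)%N).
Proof.
move=> H; have [h00 h01 h10] := straight11.
have lt : (index (0, 1) T < index (1, 1) T)%N.
  by apply: (SYT_next TX); rewrite // /next_to eqxx orbT.
have m01 : (0, 1)%N \in T by rewrite (SYT_mem TX).
have m11 : (1, 1)%N \in T by rewrite (SYT_mem TX).
have l11 : (index (1, 1)%N T < size T)%N by rewrite index_mem.
have inc q : (q <= p)%N -> (q < size T)%N -> (q <= (at_ T q).1)%N.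
  elim: q => // q IH leq ltq; have := H q ltq; rewrite /des_at ltq leq /=.
  by move=> d; apply: leq_ltn_trans d; apply: IH; apply: ltnW.
have i0 : index (0, 1)%N T != 0%N.
  by apply/eqP => e; have := nth_index (0, 0)%N m01; rewrite e at0.
have gtp : (p < index (0, 1)%N T)%N.
  rewrite ltnNge; apply/negP => le; have := inc _ le.
  by rewrite nth_index // index_mem m01 /= => /(_ isT); rewrite leqn0 (negbTE i0).
have : ((at_ T (index (1, 1)%N T)).1 <= (at_ T (index (0, 1)%N T)).1)%N.
  apply: no_des_rows => //; first exact: ltnW.
  move=> d /andP[ld ud]; rewrite H; first by rewrite -leqNgt; apply: leq_trans ld; apply: ltnW.
  exact: leq_ltn_trans ud l11.
by rewrite !nth_index.
Qed.

(** All positions up to [p] lie in row 0, so (1, 0) comes after [p]; from there on rows strictly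
    increase, and (1, 1), which comes later, would lie below row 1. *)
Lemma asc_not_prefix p : ~ (forall i, (i.+1 < size T)%N -> ~~ des_at T i = (i < p)%N).
Proof.
move=> H; have [h00 h01 h10] := straight11.
have lt : (index (1, 0) T < index (1, 1) T)%N.
  by apply: (SYT_next TX); rewrite // /next_to eqxx.
have m10 : (1, 0)%N \in T by rewrite (SYT_mem TX).
have m11 : (1, 1)%N \in T by rewrite (SYT_mem TX).
have l11 : (index (1, 1)%N T < size T)%N by rewrite index_mem.
have flat q : (q <= p)%N -> (q < size T)%N -> (at_ T q).1 = 0%N.
  move=> leq ltq; have := @no_des_rows T 0 q isT ltq.
  rewrite at0 leqn0 => h; apply/eqP/h => d /andP[_ ld].
  by rewrite H; [exact: leq_trans ld leq | exact: leq_ltn_trans ld ltq].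
have gtp : (p < index (1, 0)%N T)%N.
  rewrite ltnNge; apply/negP => le; have := flat _ le.
  by rewrite nth_index // index_mem m10 => /(_ isT).
have inc k : (index (1, 0)%N T + k < size T)%N -> (1 + k <= (at_ T (index (1, 0)%N T + k)).1)%N.
  elim: k => [|k IH]; first by rewrite addn0 nth_index.
  rewrite addnS => ltk; have := H _ ltk; rewrite /des_at ltk /= ltnNge negbK.
  have -> : (index (1, 0)%N T + k < p)%N = false.
    by apply/negbTE; rewrite -leqNgt; apply: leq_trans (leq_addr _ _); apply: ltnW.
  move/negbT; rewrite -ltnNge addnS; apply: leq_ltn_trans.
  by apply: IH; apply: ltnW.
have := inc (index (1, 1)%N T - index (1, 0)%N T)%N.
rewrite subnKC ?(ltnW lt) // l11 nth_index //= => /(_ isT).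
by rewrite -subn_gt0 in lt; rewrite add1n ltnNge lt.
Qed.
End NoPrefix.

(** * The cyclic family of fixed spaces *)

Lemma card_ord_lt n p : (p <= n)%N -> #|[set i : 'I_n | (i < p)%N]| = p.
Proof.
move=> le; rewrite -sum1_card (eq_bigl (fun i : 'I_n => (i < p)%N)) => [|i]; last by rewrite inE.
by rewrite -(big_ord_widen n (fun=> 1%N)) // sum1_card card_ord.
Qed.

Section CyclicFamily.
Variable la : seq nat.
Hypothesis la_part : is_partition la.
Notation Y := (cells la [::]).
Notation X := (SYT la [::]).
Notation tab := (seq_sub X).
Notation E := {ffun tab -> rat^o}.
Notation n := (size Y).
Hypothesis n_ge2 : (1 < n)%N.

Definition rotate : E -> E := rho (@seminormal la) n.-1.
Definition rotateL : 'End(E) := linfun rotate.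
Definition img p (U : {vspace E}) : {vspace E} := iter p (fun W => (rotateL @: W)%VS) U.

Lemma gen_lt i : (i < n.-1)%N -> (i.+1 < n)%N.
Proof. by case: n n_ge2. Qed.

Lemma invol_ i f : (i < n.-1)%N -> seminormal i (seminormal i f) = f :> E.
Proof. by move=> /gen_lt; apply: seminormal_invol. Qed.
Lemma comm_ i j f : (i.+1 < j)%N -> (j < n.-1)%N ->
  seminormal i (seminormal j f) = seminormal j (seminormal i f) :> E.
Proof. by move=> lt /gen_lt; apply: seminormal_comm. Qed.
Lemma braid_ i f : (i.+1 < n.-1)%N ->
  seminormal i (seminormal i.+1 (seminormal i f)) =
  seminormal i.+1 (seminormal i (seminormal i.+1 f)) :> E.
Proof. by move=> /gen_lt; apply: seminormal_braid. Qed.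

Lemma rotateLE f : rotateL f = rotate f.
Proof. exact: lfunE. Qed.

Lemma rotate_inj : injective rotate.
Proof. exact: can_inj (rhoK invol_). Qed.

Lemma img_fixv_cond i j : (forall f, rotate (seminormal i f) = seminormal j (rotate f)) ->
  (rotateL @: fixv la i)%VS = fixv la j.
Proof.
move=> H; apply/eqP; rewrite eqEsubv; apply/andP; split; apply/subvP=> f.
  by case/memv_imgP=> g /fixvP gf ->; apply/fixvP; rewrite rotateLE -H gf.
move/fixvP=> fj; apply/memv_imgP.
exists (rho_inv (@seminormal la) n.-1 f); last by rewrite rotateLE /rotate (rho_invK invol_).
by apply/fixvP/rotate_inj; rewrite H /rotate (rho_invK invol_).
Qed.

Lemma img_shift i : (i.+1 < n.-1)%N -> (rotateL @: fixv la i)%VS = fixv la i.+1.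
Proof.
by move=> lti; apply: img_fixv_cond => f; apply: (rho_shift comm_ braid_).
Qed.

Lemma img_wrap : (rotateL @: (rotateL @: fixv la n.-2))%VS = fixv la 0.
Proof.
have m0 : (0 < n.-1)%N by rewrite -subn1 subn_gt0.
rewrite -limg_comp; apply/eqP; rewrite eqEsubv.
have W f : rotate (rotate (seminormal n.-2 f)) = seminormal 0 (rotate (rotate f)).
  exact: (rho_wrap invol_ comm_ braid_).
apply/andP; split; apply/subvP=> f.
  case/memv_imgP=> g /fixvP gf ->; apply/fixvP.
  by rewrite comp_lfunE !rotateLE -W gf.
move/fixvP=> fj; apply/memv_imgP.
pose h := rho_inv (@seminormal la) n.-1 (rho_inv (@seminormal la) n.-1 f).
have hE : rotate (rotate h) = f by rewrite /rotate !(rho_invK invol_).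
exists h; last by rewrite comp_lfunE !rotateLE hE.
by apply/fixvP/rotate_inj/rotate_inj; rewrite W hE.
Qed.

Lemma img_fixv0 l : (l < n.-1)%N -> img l (fixv la 0) = fixv la l.
Proof.
by elim: l => //= l IH ltl; rewrite IH ?img_shift // ltnW.
Qed.

Lemma img_period : img n (fixv la 0) = fixv la 0.
Proof.
have e : n = n.-2.+2 by case: n n_ge2 => [|[]].
rewrite /img e !iterS -/(img _ _) img_fixv0 ?img_wrap //.
by rewrite {2}e.
Qed.

Lemma img_add p q U : img (p + q) U = img p (img q U).
Proof. exact: iterD. Qed.

Lemma img_span p (b : tab -> E) S :
  img p (span_of b S) = span_of (fun t => iter p rotate (b t)) S.
Proof.
elim: p => //= p ->; rewrite /span_of limg_sum; apply: eq_bigr => t _.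
by rewrite limg_line rotateLE.
Qed.

(** For [i < n.-1] this is [fixv la i]; the last index gives the additional space. Defining all of
    them as iterates of one space makes the cyclic symmetry uniform. *)
Definition Uc (i : 'I_n) : {vspace E} := img i (fixv la 0).
Definition asc (t : tab) : {set 'I_n} := [set i : 'I_n | (i.+1 < n)%N && ~~ des_at (val t) i].
(** The basis [bvec] serves the spaces with indices 0 to n - 2; rotating it [k.+1] times makes it
    serve all indices modulo n except [k]. *)
Definition cb (k : 'I_n) (t : tab) : E := iter k.+1 rotate (bvec t).
Definition cP (k : 'I_n) (t : tab) : {set 'I_n} := iter k.+1 (@shift1 n) (asc t).

Lemma img_full p : img p fullv = fullv.
Proof.
elim: p => //= p ->; apply/eqP; rewrite eqEsubv subvf; apply/subvP=> f _.
apply/memv_imgP; exists (rho_inv (@seminormal la) n.-1 f); first exact: memvf.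
by rewrite rotateLE /rotate (rho_invK invol_).
Qed.

Lemma cb_span k : span_of (cb k) setT = fullv.
Proof. by rewrite -img_span bvec_span // img_full. Qed.

Lemma cUE k i : i != k -> Uc i = span_of (cb k) [set t | i \in cP k t].
Proof.
move=> ik; pose l := ((i + (n - k.+1)) %% n)%N.
have n0 : (0 < n)%N by apply: ltnW.
have ltl : (l < n)%N by rewrite ltn_pmod.
have lk : (k.+1 + l = i \/ k.+1 + l = i + n)%N.
  rewrite /l; have [lt|ge] := ltnP (i + (n - k.+1)) n.
    by right; rewrite modn_small //; move: (ltn_ord k); clear; lia.
  left; have -> : (i + (n - k.+1) = (i - k.+1) + n)%N.
    by move: ge (ltn_ord k); clear; lia.
  rewrite modnDr modn_small; move: ge (ltn_ord k) (ltn_ord i); clear; lia.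
have ltl' : (l < n.-1)%N.
  have := ik; rewrite -val_eqE /=; move: lk ltl (ltn_ord i) (ltn_ord k); clear; lia.
have iE : i = iter k.+1 (@ordS n) (Ordinal ltl).
  apply: val_inj; rewrite val_iter_ordS /= addnC.
  by case: lk => ->; rewrite ?modnDr modn_small.
have -> : Uc i = img (k.+1 + l) (fixv la 0).
  by rewrite /Uc; case: lk => -> //; rewrite img_add img_period.
rewrite img_add img_fixv0 // fixvE // ?gen_lt // img_span; congr (span_of _ _).
by apply/setP=> t; rewrite [RHS]inE iE mem_iter_shift1 !inE /= gen_lt.
Qed.

Lemma cP_omits k t : k \notin cP k t.
Proof.
have n0 : (0 < n)%N by apply: ltnW.
have lt : (n.-1 < n)%N by rewrite prednK.
have kE : k = iter k.+1 (@ordS n) (Ordinal lt).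
  apply: val_inj; rewrite val_iter_ordS /= addnS -addSn prednK //.
  by rewrite modnDl modn_small.
by rewrite {1}kE mem_iter_shift1 inE /= prednK // ltnn.
Qed.

Notation q := (excess Uc).
Notation d := (exact_count cP).

Hypothesis has11 : (1, 1)%N \in Y.

Lemma asc_prefix0 p (t : tab) : asc t != [set i : 'I_n | (i < p)%N].
Proof.
apply/eqP => e; apply: (@asc_not_prefix la la_part has11 (val t) (valP t) p) => i.
rewrite size_tab => lti; have lti' : (i < n)%N by apply: ltnW.
by have /setP/(_ (Ordinal lti')) := e; rewrite !inE /= lti.
Qed.

Lemma q_rec (J : {set 'I_n}) k : k \notin J -> (q J + q (k |: J) = d k J)%N.
Proof.
apply: (excess_recursion cb_span _ cUE cP_omits); first exact: dim_ffun_tab.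
move=> p; rewrite card_ord => ltp.
have n0 : (0 < n)%N by apply: ltnW.
have ltm : (n.-1 < n)%N by rewrite prednK.
pose k0 := Ordinal ltm; pose J0 := [set i : 'I_n | (i < p)%N].
have k0J : k0 \notin J0 by rewrite inE /= -leqNgt -ltnS prednK.
have ple : (p <= n.-1)%N by rewrite -ltnS prednK.
(* For the last index [k0] the rotation by [k0.+1 = n] steps is trivial, so [d k0] counts tableaux
   by their plain ascent sets. *)
have d0 : d k0 J0 = 0%N.
  apply/eqP; rewrite cards_eq0; apply/eqP/setP=> t; rewrite !inE.
  rewrite /cP prednK // iter_shift1_id; exact/negbTE/asc_prefix0.
exists J0, k0; split=> //.
- by apply: card_ord_lt; apply: ltnW.
- apply/eqP; rewrite -leqn0 -d0; apply: (excess_le cb_span _ cUE cP_omits) => //.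
  exact: dim_ffun_tab.
(* When [k0 |: J0] is everything, no index is left to omit. The excess is bounded instead by the
   dimension of [meet Uc J0], which is 0 because no further index apart from [k0] can be added. *)
have [e|ne] := eqVneq p n.-1.
  have fullE : k0 |: J0 = setT.
    apply/setP=> i; rewrite !inE -val_eqE /= e.
    by move: (ltn_ord i) n0; clear; lia.
  have dm : \dim (meet Uc J0) = 0%N.
    rewrite (exact_countE cb_span (dim_ffun_tab la) cUE cP_omits k0J) d0 add0n fullE.
    by rewrite /above big1 ?dimv0 // => j; rewrite inE.
  apply/eqP; rewrite -leqn0; apply: leq_trans (leq_subr _ _) _.
  by rewrite -dm; apply: dimvS; apply: meetS; apply: subsetUr.
have ltp2 : (p < n.-1)%N by rewrite ltn_neqAle ne.
have ltm2 : (n.-2 < n)%N by exact: (leq_ltn_trans (leq_pred _) ltm).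
have m0 : (0 < n.-1)%N by apply: leq_ltn_trans ltp2.
pose k1 := Ordinal ltm2.
have k1J : k1 \notin k0 |: J0.
  rewrite !inE negb_or -val_eqE /= -leqNgt -ltnS prednK // ltp2 andbT.
  by rewrite neq_ltn -{2}(prednK m0) ltnS leqnn.
apply/eqP; rewrite -leqn0.
apply: leq_trans (excess_le cb_span (dim_ffun_tab la) cUE cP_omits k1J) _.
rewrite leqn0 cards_eq0; apply/eqP/setP=> t; rewrite !inE.
apply/negbTE; rewrite /cP /= -iterS prednK //.
(* Omitting [k1 = n.-2] rotates ascent sets by [n.-1] steps, that is, one step back, and one step
   back from the prefix of size [p.+1] is [k0 |: J0]. *)
have -> : k0 |: J0 = iter n.-1 (@shift1 n) [set i : 'I_n | (i < p.+1)%N].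
  apply/setP=> i.
  have iE : i = iter n.-1 (@ordS n) (ordS i).
    by apply: val_inj; rewrite -iterSr val_iter_ordS prednK // modnDr modn_small.
  rewrite [in RHS]iE mem_iter_shift1 !inE -val_eqE /=.
  have [->|ni] := eqVneq (val i) n.-1; first by rewrite prednK // modnn.
  have ni' : nat_of_ord i != n.-1 by [].
  by rewrite modn_small ?ltnS //; move: (ltn_ord i) ni'; clear; lia.
by rewrite iter_shift1_eq asc_prefix0.
Qed.

End CyclicFamily.

(** * Cyclic lifts of descent counts *)

Local Close Scope ring_scope.

(* [~: nm1 n] is the singleton of the last index. *)
Definition cyclic_lift n (d c : {set 'I_n} -> nat) : Prop :=
  [/\ forall J : {set 'I_n}, c (shift1 J) = c J,
      forall J : {set 'I_n}, J \subset nm1 n -> c J + c (~: nm1 n :|: J) = d J,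
      c set0 = 0 & c setT = 0].

Definition des_count n la mu (J : {set 'I_n}) : nat :=
  count (fun T => DesT n T == J) (SYT la mu).

Lemma card_seq_sub_count (T : choiceType) (s : seq T) (P : pred T) : uniq s ->
  #|[set t : seq_sub s | P (val t)]| = count P s.
Proof.
move=> us; have e : perm_eq [seq val t | t <- enum {: seq_sub s}] s.
  apply: uniq_perm => //; first by rewrite map_inj_uniq ?enum_uniq //; apply: val_inj.
  move=> x; apply/mapP/idP => [[t _ ->]|xs]; first exact: (valP t).
  by exists (SeqSub xs); rewrite ?mem_enum.
rewrite -(seq.permP e) count_map cardsE cardE -size_filter; congr size.
by rewrite enumT; apply: eq_filter.
Qed.

Lemma setC_nm1 n (k : 'I_n) : k.+1 = n -> ~: nm1 n = [set k].
Proof.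
move=> ek; apply/setP=> i; rewrite !inE -val_eqE /=; move: (ltn_ord i) ek; clear; lia.
Qed.

(** The excess [q] follows ascents, so the lift is [q] at complements. The recursion at the last
    index becomes the lift equation, and prefixes supply all vanishing statements. *)
Lemma nonhook_lift n la : is_partition la -> size (cells la [::]) = n -> 1 < n ->
  (1, 1) \in cells la [::] ->
  exists2 c, cyclic_lift (@des_count n la [::]) c &
    forall p, c [set i : 'I_n | i < p] = 0.
Proof.
move=> la_part sz; rewrite -{n}sz; set n := size _ => n2 has11.
have n0 : 0 < n by apply: ltnW.
have ltm : n.-1 < n by rewrite prednK.
pose k0 : 'I_n := Ordinal ltm; have ek0 : k0.+1 = n by rewrite /= prednK.
pose q := excess (@Uc la); pose d := exact_count (@cP la).
have rec (J : {set 'I_n}) k : k \notin J -> q J + q (k |: J) = d k J by apply: q_rec.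
have dS k J : d (ordS k) (shift1 J) = d k J.
  apply: eq_card => t; rewrite !inE -[RHS](iter_shift1_eq 1); congr (_ == _).
  rewrite /cP /= -!iterS; have [e|ne] := eqVneq k.+1 n.
    by rewrite e modnn /= iter_shift1_id.
  by rewrite modn_small // ltn_neqAle ne ltn_ord.
(* Rotation invariance is drawn from the recursion by removing one element at a time, since [d] is
   invariant when the index and the set rotate together. *)
have qS K : q (shift1 K) = q K.
  have [m] := ubnP #|K|; elim: m K => // m IH K.
  have [->|[k kK]] := set_0Vmem K; first by rewrite /shift1 imset0.
  rewrite (cardsD1 k) kK ltnS => le; have := rec (K :\ k) k.
  have := rec (shift1 (K :\ k)) (ordS k).
  rewrite -shift1U1 setD1K // dS mem_shift1 !inE eqxx IH //=.
  by move=> /(_ isT) h1 /(_ isT) h2; apply/eqP; rewrite -(eqn_add2l (q (K :\ k))) h1 h2.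
have cP0 t : cP k0 t = asc t by rewrite /cP ek0 iter_shift1_id.
have pref p : d k0 [set i : 'I_n | i < p] = 0.
  by apply/eqP; rewrite cards_eq0; apply/eqP/setP=> t; rewrite !inE cP0 (negbTE (asc_prefix0 _ _ _ _)).
have q0 : q set0 = 0.
  have := rec set0 k0; rewrite inE => /(_ isT).
  have -> : set0 = [set i : 'I_n | i < 0] by apply/setP=> i; rewrite !inE.
  by rewrite pref => /eqP; rewrite addn_eq0 => /andP[/eqP].
have qT : q setT = 0.
  have := rec [set i : 'I_n | i < n.-1] k0; rewrite inE /= ltnn => /(_ isT).
  rewrite pref (_ : k0 |: _ = setT) => [/eqP|]; first by rewrite addn_eq0 => /andP[_ /eqP].
  by apply/setP=> i; rewrite !inE -val_eqE /=; move: (ltn_ord i) n0; clear; lia.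
(* At [k0] the exact count is by ascent sets, which are the complements in [nm1 n] of descent
   sets. *)
have dE (J : {set 'I_n}) : J \subset nm1 n ->
    q (~: J) + q (~: (~: nm1 n :|: J)) = des_count la [::] J.
  move=> sJ; rewrite (setC_nm1 ek0).
  have k0J : k0 \notin J by apply/negP => /(subsetP sJ); rewrite inE ek0 ltnn.
  have := rec (~: (k0 |: J)) k0; rewrite !inE eqxx /= => /(_ isT).
  have -> : k0 |: ~: (k0 |: J) = ~: J.
    by apply/setP=> i; rewrite !inE; case: eqP => // ->; rewrite k0J.
  rewrite addnC => ->; rewrite /des_count -card_seq_sub_count ?uniq_SYT //.
  apply: eq_card => t; rewrite !inE cP0.
  have Dn : DesT n (val t) \subset nm1 n.
    by apply/subsetP=> i; rewrite !inE => /andP[].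
  have aE : asc t = nm1 n :\: DesT n (val t).
    by apply/setP=> i; rewrite !inE /des_at size_tab; case: (_ < n); rewrite ?andbF ?andbT.
  have kE : ~: (k0 |: J) = nm1 n :\: J by rewrite -(setC_nm1 ek0) setCU setCK setDE.
  rewrite aE kE; apply/eqP/eqP => [e|->//].
  have := congr1 (fun S => nm1 n :\: S) e; rewrite !setDDr !setDv !set0U.
  by rewrite (setIidPr Dn) (setIidPr sJ).
exists (fun J => q (~: J)).
  by split=> [J|//||]; rewrite ?setC0 ?setCT // -shift1C qS.
move=> p; have [le|gt] := leqP n p.
  rewrite (_ : [set _ | _] = setT) ?setCT //.
  by apply/setP=> i; rewrite !inE; apply: leq_trans le.
have sJ : [set i : 'I_n | i < p] \subset nm1 n.
  by apply/subsetP=> i; rewrite !inE => lt; apply: leq_ltn_trans lt gt.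
have := dE _ sJ; rewrite (_ : des_count _ _ _ = 0) => [/eqP|].
  by rewrite addn_eq0 => /andP[/eqP].
apply/eqP; rewrite eqn0Ngt -has_count; apply/hasPn=> T TX; apply/eqP => e.
apply: (@des_not_prefix la la_part has11 T TX p) => i; rewrite (SYT_size TX) => lti.
have lti' : i < n by apply: ltnW.
have /setP/(_ (Ordinal lti')) := e; rewrite !inE /= lti /= => <-.
by rewrite /des_at (SYT_size TX) lti.
Qed.

Lemma count_index_lt (T : eqType) (s : seq T) k : uniq s -> k <= size s ->
  count (fun x => index x s < k) s = k.
Proof.
move=> us le; rewrite (eq_in_count (a2 := mem (take k s))) => [|x xs]; last first.
  by rewrite /= in_take.
rewrite -[in X in count _ X](cat_take_drop k s) count_cat.
rewrite (eq_in_count (a2 := predT)) => [|x /= -> //]; rewrite count_predT size_take_min.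
rewrite (minn_idPl le) (_ : count _ _ = 0) ?addn0 //.
apply/eqP; rewrite eqn0Ngt -has_count; apply/hasPn=> x xd /=.
by move: us; rewrite -{1}(cat_take_drop k s) cat_uniq => /and3P[_ /hasPn/(_ x xd)].
Qed.

Lemma DesT_sub n T : DesT n T \subset nm1 n.
Proof. by apply/subsetP=> i; rewrite !inE => /andP[]. Qed.

(** * From a cyclic lift to a cyclic descent extension *)

Section LiftToExtension.
Variables (n : nat) (la mu : seq nat) (c : {set 'I_n} -> nat).
Hypothesis n_gt0 : 0 < n.
Hypothesis c_lift : cyclic_lift (@des_count n la mu) c.
Notation X := (SYT la mu).
Notation L D := [seq T <- X | DesT n T == D].

(** Among the tableaux with descent set [D], the first [c D] in list order keep [D] and the others
    receive the last index as well; the lift equation says that the latter are as many as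
    required. *)
Definition lift_cDes (T : seq (nat * nat)) : {set 'I_n} :=
  let D := DesT n T in if index T (L D) < c D then D else ~: nm1 n :|: D.

Lemma lift_cDes_nm1 T : lift_cDes T :&: nm1 n = DesT n T.
Proof.
rewrite /lift_cDes; case: ifP => _; first by apply/setIidPl; apply: DesT_sub.
by rewrite setIUl [~: _ :&: _]setIC setICr set0U; apply/setIidPl; apply: DesT_sub.
Qed.

Lemma lift_cDes_last T : T \in X ->
  (lift_cDes T == DesT n T) = (index T (L (DesT n T)) < c (DesT n T)).
Proof.
move=> TX; rewrite /lift_cDes; case: ifP => [_|_]; first by rewrite eqxx.
apply/eqP => e; have lt : n.-1 < n by rewrite prednK.
have := subsetP (DesT_sub n T) (Ordinal lt); rewrite -e !inE /= prednK // ltnn.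
by move/(_ isT).
Qed.

Lemma count_lift_cDes J : count (fun T => lift_cDes T == J) X = c J.
Proof.
have [_ rec _ _] := c_lift; pose D := J :&: nm1 n.
have sD : D \subset nm1 n by apply: subsetIr.
have uL : uniq (L D) by rewrite filter_uniq // uniq_SYT.
have szL : size (L D) = c D + c (~: nm1 n :|: D) by rewrite rec // size_filter.
have low : count (fun T => index T (L D) < c D) (L D) = c D.
  by apply: count_index_lt => //; rewrite szL leq_addr.
have TD T : lift_cDes T = J -> DesT n T = D by move=> e; rewrite /D -e lift_cDes_nm1.
rewrite -(eq_in_count (a1 := predI (fun T => lift_cDes T == J) (fun T => DesT n T == D))); last first.
  by move=> T _ /=; case: eqP => //= /TD ->; rewrite eqxx.
rewrite -count_filter; have [JD|JD] := eqVneq J D.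
  have -> : c J = c D by congr c.
  rewrite -low; apply: eq_in_count => T; rewrite mem_filter => /andP[/eqP e TX].
  by rewrite JD -e lift_cDes_last.
have JE : J = ~: nm1 n :|: D.
  apply/setP=> i; rewrite !inE; case: (boolP (i.+1 < n)) => ni /=; first by rewrite andbT.
  have lt : n.-1 < n by rewrite prednK.
  have [k ek] : exists k : 'I_n, k.+1 = n by exists (Ordinal lt); rewrite /= prednK.
  have kN := setC_nm1 ek; have ik : i = k.
    by apply/eqP; rewrite -in_set1 -kN !inE ni.
  rewrite ik; apply: contraNT JD => kJ; apply/eqP/setP=> j; rewrite !inE.
  case: (boolP (j.+1 < n)) => [|nj]; rewrite ?andbT // andbF.
  have -> : j = k by apply/eqP; rewrite -in_set1 -kN !inE nj.
  exact: negbTE.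
apply/eqP; rewrite -(eqn_add2l (c D)) {2}JE -szL -low -(count_predC (fun T => index T (L D) < c D)).
rewrite low eqn_add2l; apply/eqP/eq_in_count => T; rewrite mem_filter => /andP[/eqP e TX] /=.
rewrite -e -lift_cDes_last // e.
rewrite /lift_cDes e; case: ifP => _; first by rewrite eqxx eq_sym (negbTE JD).
by rewrite -JE eqxx JD.
Qed.

Notation M J := [seq T <- X | lift_cDes T == J].

Lemma size_M J : size (M J) = c J.
Proof. by rewrite size_filter count_lift_cDes. Qed.

Definition unshift1 (J : {set 'I_n}) := iter n.-1 (@shift1 n) J.

Lemma shift1K : cancel (@shift1 n) unshift1.
Proof. by move=> J; rewrite /unshift1 -iterSr prednK // iter_shift1_id. Qed.
Lemma unshift1K : cancel unshift1 (@shift1 n).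
Proof. by move=> J; rewrite /unshift1 -iterS prednK // iter_shift1_id. Qed.

(** Fibres of [lift_cDes] over [J] and [g J] have equal size when [c] is invariant under [g], and
    are matched by rank. The default [T] is then never reached. *)
Definition lift_move (g : {set 'I_n} -> {set 'I_n}) (T : seq (nat * nat)) :=
  nth T (M (g (lift_cDes T))) (index T (M (lift_cDes T))).

Lemma lift_moveP g T : (forall J, c (g J) = c J) -> T \in X ->
  lift_move g T \in M (g (lift_cDes T)).
Proof.
move=> cg TX; rewrite /lift_move mem_nth // size_M cg -size_M index_mem.
by rewrite mem_filter eqxx.
Qed.

Lemma lift_moveK g h T : (forall J, c (g J) = c J) -> cancel g h -> T \in X ->
  lift_move h (lift_move g T) = T.
Proof.
move=> cg gK TX; have := lift_moveP cg TX; rewrite mem_filter => /andP[/eqP e _].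
have lt : index T (M (lift_cDes T)) < size (M (lift_cDes T)).
  by rewrite index_mem mem_filter eqxx.
rewrite {1}/lift_move e gK {2}/lift_move index_uniq.
- by rewrite nth_index // mem_filter eqxx.
- by rewrite size_M cg -size_M.
- by rewrite filter_uniq // uniq_SYT.
Qed.

Lemma lift_extension : exists psi, cyc_desc_ext la mu lift_cDes psi.
Proof.
have [cS _ c0 cT] := c_lift.
have cU J : c (unshift1 J) = c J by rewrite -[in RHS](unshift1K J) cS.
have none J T : c J = 0 -> T \in X -> lift_cDes T != J.
  move=> cJ TX; have /eqP := count_lift_cDes J; rewrite cJ eqn0Ngt -has_count.
  by move/hasPn/(_ T TX).
exists (lift_move (@shift1 n)); split=> [T TX|T TX||T TX|T TX].
- exact: lift_cDes_nm1.
- by have := lift_moveP cS TX; rewrite mem_filter => /andP[].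
- exists (lift_move unshift1) => [T TX|].
    by have := lift_moveP cU TX; rewrite mem_filter => /andP[].
  by split=> T TX; apply: lift_moveK => //; [apply: shift1K | apply: unshift1K].
- by have := lift_moveP cS TX; rewrite mem_filter => /andP[/eqP].
- by split; apply: none.
Qed.

End LiftToExtension.

(** * Hooks and two-piece shapes *)

Lemma sorted_by_index (U : eqType) (s : seq U) : uniq s ->
  sorted (relpre (index^~ s) ltn) s.
Proof.
case es: s => [//|x0 s0] us; rewrite -es in us *; apply/(sortedP x0) => i lti.
by rewrite /relpre /= !index_uniq //; apply: ltnW.
Qed.

Lemma sorted_filter_index (U : eqType) (s : seq U) (p : pred U) : uniq s ->
  sorted (relpre (index^~ s) ltn) (filter p s).
Proof.
move=> us; apply: sorted_filter (sorted_by_index us) => y x z /=; exact: ltn_trans.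
Qed.

Section HookLike.
Variables (a b m : nat) (mu : seq nat).
Hypothesis mu0 : nth 0 mu 0 = m.
Hypothesis muS : forall i, nth 0 mu i.+1 = 0.
Hypothesis corner : m = 0 -> 0 < a.
Notation la := (a :: nseq b 1).
Notation row0 := (fun c : cell => c.1 == 0).
(** Hooks and two-piece shapes are handled together: [m = 0] gives the hook, while [m = 1] removes
    the corner and leaves a row and a column that do not touch. *)
Definition arm_cells : seq cell := [seq (0, j) | j <- iota m (a - m)].
Definition leg_cells : seq cell := [seq (i.+1, 0) | i <- iota 0 b].

Lemma mem_hook_like (c : cell) : (c \in cells la mu) = (c \in arm_cells ++ leg_cells).
Proof.
rewrite mem_cells mem_cat; apply/idP/orP.
  case: c => [[|i] j] /=; rewrite ?mu0 ?muS ?size_nseq.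
    by move=> h; left; apply/mapP; exists j; rewrite ?mem_iota //; lia.
  rewrite nth_nseq; case: ifP => [lt h|]; last by lia.
  by right; apply/mapP; exists i; [rewrite mem_iota; lia | congr pair; lia].
case=> /mapP[j]; rewrite mem_iota => lt -> /=; rewrite ?mu0 ?muS ?size_nseq; first lia.
by rewrite nth_nseq; case: ifP; lia.
Qed.

Lemma uniq_arm_leg : uniq (arm_cells ++ leg_cells).
Proof.
rewrite cat_uniq !map_inj_uniq ?iota_uniq ?andbT /=; try by move=> x y [].
by apply/hasPn=> c /mapP[i _ ->]; apply/mapP=> -[].
Qed.

Lemma filter_row0 : filter row0 (arm_cells ++ leg_cells) = arm_cells.
Proof.
rewrite filter_cat (_ : filter row0 arm_cells = arm_cells).
  by rewrite (_ : filter _ leg_cells = [::]) ?cats0 //; rewrite /leg_cells; elim: (iota 0 b).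
by rewrite /arm_cells; elim: (iota m _) => //= j s ->.
Qed.

Lemma filter_leg : filter (predC row0) (arm_cells ++ leg_cells) = leg_cells.
Proof.
rewrite filter_cat (_ : filter _ arm_cells = [::]) /=.
  by rewrite /leg_cells; elim: (iota 0 b) => //= i s ->.
by rewrite /arm_cells; elim: (iota m _).
Qed.

(** The order relations run along the arm, along the leg, and through the corner if it is present. A
    standard filling is thus a shuffle of arm and leg, with the corner in front when [m = 0]. *)
Lemma hook_like_SYT T : (T \in SYT la mu) =
  [&& filter row0 T == arm_cells, filter (predC row0) T == leg_cells &
      (m == 0) ==> (nth (0, 0) T 0 == (0, 0))].
Proof.
have irr (s : seq cell) : irreflexive (relpre (index^~ s) ltn).
  by move=> x /=; rewrite ltnn.
have tr (s : seq cell) : transitive (relpre (index^~ s) ltn).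
  by move=> y x z /=; apply: ltn_trans.
apply/idP/and3P => [TX|[/eqP f0 /eqP f1 hd]].
  have uT := SYT_uniq TX; have mT := SYT_mem TX.
  have nx (c d : cell) : c \in arm_cells ++ leg_cells -> d \in arm_cells ++ leg_cells ->
      next_to c d -> index c T < index d T.
    by rewrite -!mem_hook_like; apply: SYT_next.
  split.
  - apply/eqP/(irr_sorted_eq (tr T) (irr T)); first exact: sorted_filter_index.
      apply/(sortedP (0, 0)) => j; rewrite size_map size_iota => ltj.
      have lt' : j < a - m by apply: ltnW.
      apply: nx; rewrite ?mem_cat ?mem_nth ?size_map ?size_iota //.
      by rewrite !(nth_map 0) ?size_iota // !nth_iota // /next_to /= addnS eqxx.
    by move=> c; rewrite mem_filter mT mem_hook_like -[in RHS]filter_row0 mem_filter.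
  - apply/eqP/(irr_sorted_eq (tr T) (irr T)); first exact: sorted_filter_index.
      apply/(sortedP (0, 0)) => j; rewrite size_map size_iota => ltj.
      have lt' : j < b by apply: ltnW.
      apply: nx; rewrite ?mem_cat ?mem_nth ?size_map ?size_iota ?orbT //.
      by rewrite !(nth_map 0) ?size_iota // !nth_iota // /next_to /= !add0n eqxx orbT.
    by move=> c; rewrite mem_filter mT mem_hook_like -[in RHS]filter_leg mem_filter.
  apply/implyP => /eqP m0.
  have c0 : (0, 0) \in arm_cells ++ leg_cells.
    by rewrite mem_cat; apply/orP; left; apply/mapP; exists 0; rewrite ?mem_iota ?m0 ?subn0 //= corner.
  have cT : (0, 0) \in T by rewrite mT mem_hook_like.
  have col j : (j, 0) \in arm_cells ++ leg_cells -> index (0, 0) T <= index (j, 0) T.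
    elim: j => // -[_|j IH] h; first by apply/ltnW/nx; rewrite // /next_to eqxx orbT.
    have h' : (j.+1, 0) \in arm_cells ++ leg_cells.
      move: h; rewrite !mem_cat => /orP[/mapP[? _ []] //|/mapP[i]]; rewrite mem_iota => lt [e].
      by apply/orP; right; apply/mapP; exists j; rewrite ?mem_iota //; lia.
    apply: leq_trans (IH h') _; apply/ltnW/nx => //; rewrite /next_to eqxx orbT //.
  have arm j : (0, j) \in arm_cells ++ leg_cells -> index (0, 0) T <= index (0, j) T.
    elim: j => // j IH h.
    have h' : (0, j) \in arm_cells ++ leg_cells.
      move: h; rewrite !mem_cat => /orP[/mapP[i]|/mapP[? _ []] //]; rewrite mem_iota => lt [e].
      by apply/orP; left; apply/mapP; exists j; rewrite ?mem_iota //; lia.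
    by apply: leq_trans (IH h') _; apply/ltnW/nx => //; rewrite /next_to eqxx.
  have sT : 0 < size T by case: (T) cT.
  have hT : nth (0, 0) T 0 \in arm_cells ++ leg_cells by rewrite -mem_hook_like -mT mem_nth.
  have : index (0, 0) T <= index (nth (0, 0) T 0) T.
    move: hT; rewrite mem_cat => /orP[/mapP[j jj e]|/mapP[j jj e]]; rewrite e.
      by apply: arm; rewrite mem_cat; apply/orP; left; apply/mapP; exists j.
    by apply: col; rewrite mem_cat; apply/orP; right; apply/mapP; exists j.
  rewrite index_uniq // leqn0 => /eqP i0.
  by rewrite -[X in nth _ _ X == _]i0 nth_index.
have pT : perm_eq T (arm_cells ++ leg_cells).
  by rewrite -f0 -f1 perm_sym perm_filterC.
have uT : uniq T by rewrite (perm_uniq pT) uniq_arm_leg.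
have s0 := sorted_filter_index row0 uT; have s1 := sorted_filter_index (predC row0) uT.
rewrite f0 in s0; rewrite f1 in s1.
apply/SYT_P; split.
  apply: perm_trans pT _; apply: uniq_perm; rewrite ?uniq_arm_leg ?uniq_cells //.
  by move=> c; rewrite mem_hook_like.
move=> c d; rewrite !mem_cells.
case: c d => [ci cj] [di dj] /= hc hd'; case/orP=> /eqP[e1 e2]; rewrite {}e1 {}e2 in hd' *.
  case: ci hc hd' => [|ci] /=; rewrite ?mu0 ?muS ?nth_nseq ?size_nseq => hc hd'; last first.
    by move: hd'; case: ifP; lia.
  have := sortedP (0, 0) s0 => /(_ (cj - m)); rewrite size_map size_iota.
  rewrite !(nth_map 0) ?size_iota ?nth_iota; try lia.
  have -> : m + (cj - m) = cj by lia.
  have -> : m + (cj - m).+1 = cj.+1 by lia.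
  by apply; lia.
case: ci hc hd' => [|ci] /=; rewrite ?mu0 ?muS ?nth_nseq ?size_nseq => hc hd'.
  have [cj0 m0] : cj = 0 /\ m = 0 by move: hd'; case: ifP; lia.
  rewrite cj0; move: hd; rewrite m0 => /eqP h0.
  have sT : 0 < size T.
    by rewrite (perm_size pT) size_cat size_map size_iota m0 subn0 addn_gt0 corner.
  have i0 : index (0, 0) T = 0 by rewrite -{1}h0 index_uniq.
  rewrite i0 lt0n; apply/eqP => i1.
  have : nth (0, 0) T 0 = (1, 0).
    rewrite -[X in nth _ _ X = _]i1 nth_index // (perm_mem pT) mem_cat; apply/orP; right.
    by apply/mapP; exists 0; rewrite // mem_iota; lia.
  by rewrite h0.
have [cj0 lb] : cj = 0 /\ ci.+1 < b by move: hd' hc; do 2!case: ifP; lia.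
have := sortedP (0, 0) s1 => /(_ ci); rewrite size_map size_iota.
by rewrite !(nth_map 0) ?size_iota ?nth_iota; try lia; rewrite cj0 !add0n; apply.
Qed.

(* [w] says which entries lie in the leg, [(0, r)] and [(l.+1, 0)] are the next free
   cells of the arm and of the leg. *)
Fixpoint build (r l : nat) (w : seq bool) : seq cell :=
  match w with
  | [::] => [::]
  | true :: w' => (l.+1, 0) :: build r l.+1 w'
  | false :: w' => (0, r) :: build r.+1 l w'
  end.

Definition leg_word (T : seq cell) : seq bool := map (fun c => c.1 != 0) T.

Lemma buildK r l w : leg_word (build r l w) = w.
Proof. by elim: w r l => // -[] w IH r l /=; rewrite IH. Qed.

Lemma leg_wordK T r l p k :
  filter row0 T = [seq (0, j) | j <- iota r p] ->
  filter (predC row0) T = [seq (i.+1, 0) | i <- iota l k] ->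
  build r l (leg_word T) = T.
Proof.
elim: T r l p k => // -[[|i] j] T IH r l p k /=.
  by case: p => // p [-> h0] h1; rewrite (IH _ _ _ _ h0 h1).
by case: k => [|k]; rewrite // => h0 [-> -> h1]; rewrite (IH _ _ _ _ h0 h1).
Qed.

Lemma filter_build r l w :
  filter row0 (build r l w) = [seq (0, j) | j <- iota r (count negb w)] /\
  filter (predC row0) (build r l w) = [seq (i.+1, 0) | i <- iota l (count id w)].
Proof.
elim: w r l => // -[] w IH r l /=; first by have [-> ->] := IH r l.+1.
by have [-> ->] := IH r.+1 l.
Qed.

Lemma row_build r l w i : i < size w ->
  (nth (0, 0) (build r l w) i).1 = if nth false w i then l + count id (take i.+1 w) else 0.
Proof.
elim: w r l i => // -[] w IH r l [|i] //= lti; rewrite ?take0 /= ?addn1 //.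
  by rewrite IH //; case: ifP => // _; rewrite add1n addnS addSn.
by rewrite IH.
Qed.

(** A cell of the leg lies strictly below whatever was filled just before it, and a cell of the arm
    never does. *)
Lemma DesT_build n r l w : size w = n ->
  DesT n (build r l w) = [set i : 'I_n | (i.+1 < n) && nth false w i.+1].
Proof.
move=> sw; apply/setP=> i; rewrite !inE; case: (boolP (i.+1 < n)) => //= lti.
rewrite !row_build ?sw //.
rewrite [take i.+2 w](take_nth false) ?sw // -cats1 count_cat /=.
case: (nth false w i.+1) => /=; last by rewrite ltn0.
by case: (nth false w i); lia.
Qed.

Lemma hook_like_build w : size w = (a - m) + b ->
  (build m 0 w \in SYT la mu) = (count id w == b) && ((m == 0) ==> ~~ head false w).
Proof.
move=> sw; have [f0 f1] := filter_build m 0 w; rewrite hook_like_SYT f0 f1.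
have cw : count negb w + count id w = (a - m) + b by rewrite -sw addnC count_predC.
have eqsz (f : nat -> cell) p k k' :
    ([seq f j | j <- iota p k] == [seq f j | j <- iota p k']) = (k == k').
  apply/eqP/eqP => [/(congr1 size)|-> //]; by rewrite !size_map !size_iota.
rewrite !eqsz; have [cb|ncb] := eqVneq (count id w) b; last by rewrite andbF.
have -> : count negb w == a - m by rewrite -(eqn_add2r b) -{1}cb cw.
rewrite /=; case: eqP => //= m0; have a0 := corner m0.
have : 0 < size w by rewrite sw m0 subn0 addn_gt0 a0.
by rewrite m0; case: (w) => // -[].
Qed.

(** [J] prescribes every letter of the leg word except the first. That letter is free when [m != 0]
    and must be an arm letter when [m = 0]; the number of leg letters has to be [b]. *)
Lemma hook_like_des_count n (J : {set 'I_n}) : 0 < n -> (a - m) + b = n -> J \subset nm1 n ->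
  des_count la mu J = (#|J| == b) + ((m != 0) && (#|J|.+1 == b)).
Proof.
case: n J => // n J _ nE sJ; pose w h := h :: [seq inord i \in J | i <- iota 0 n].
have sw h : size (w h) = n.+1 by rewrite /= size_map size_iota.
have lastJ : ord_max \notin J.
  by apply/negP => /(subsetP sJ); rewrite inE /= ltnn.
have cw h : count id (w h) = h + #|J|.
  rewrite /= count_map -sum1_card big_mkcond big_ord_recr /= (negbTE lastJ) addn0.
  rewrite -sum1_count big_mkcond /= -{1}(subn0 n) big_mkord; congr (_ + _).
  apply: eq_bigr => i _; rewrite (_ : inord i = widen_ord (leqnSn n) i) //.
  by apply: val_inj; rewrite /= inordK // ltnS ltnW.
have desw h : DesT n.+1 (build m 0 (w h)) = J.
  rewrite DesT_build //; apply/setP => i; rewrite inE.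
  case: (boolP (i.+1 < n.+1)) => /= ni; last first.
    by apply/esym/negbTE; apply: contra ni => /(subsetP sJ); rewrite inE.
  by rewrite (nth_map 0) ?size_iota // nth_iota // add0n inord_val.
pose ok (h : bool) := (h + #|J| == b) && ((m == 0) ==> ~~ h).
have e : perm_eq [seq T <- SYT la mu | DesT n.+1 T == J]
    [seq build m 0 (w h) | h <- [:: false; true] & ok h].
  apply: uniq_perm; first by rewrite filter_uniq ?uniq_SYT.
    rewrite map_inj_in_uniq; first by rewrite filter_uniq.
    by move=> h h' _ _ /(congr1 leg_word); rewrite !buildK => -[].
  move=> T; rewrite mem_filter; apply/andP/mapP => [[/eqP DT TX]|[h]]; last first.
    rewrite mem_filter => /andP[ok_h _] ->; split; first by rewrite desw.
    by rewrite hook_like_build ?sw // cw.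
  have TX' := TX; move: TX'; rewrite hook_like_SYT => /and3P[/eqP f0 /eqP f1 _].
  have bT := leg_wordK f0 f1.
  have sT : size (leg_word T) = n.+1.
    rewrite size_map -nE -(count_predC row0 T) -!size_filter f0 f1.
    by rewrite !size_map !size_iota.
  have wT : leg_word T = w (head false (leg_word T)).
    apply: (@eq_from_nth _ false); rewrite ?sw // sT => -[|i] lti; first by case: (leg_word T).
    have := DT; rewrite -{1}bT DesT_build // => /setP/(_ (inord i)).
    rewrite inE inordK ?lti ?andTb; last by apply: ltnW.
    by move=> ->; rewrite /w /= (nth_map 0) ?size_iota // nth_iota.
  exists (head false (leg_word T)); last by rewrite -wT bT.
  rewrite mem_filter; apply/andP; split; last by case: (head _ _).
  by rewrite /ok -cw -wT -[X in _ ==> X]/(~~ head false (leg_word T)) -hook_like_build ?bT ?sT.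
rewrite /des_count -size_filter (perm_size e) size_map size_filter /ok /= addn0 add0n add1n.
by rewrite implybT andbT; case: (m == 0); rewrite ?andbT ?andbF.
Qed.
End HookLike.

Lemma size_straight la : size (cells la [::]) = sumn la.
Proof.
rewrite size_allpairs_dep; have -> : [seq size (iota (nth 0 [::] i) (nth 0 la i - nth 0 [::] i)) | i <- iota 0 (size la)] = la.
  apply: (@eq_from_nth _ 0); rewrite ?size_map ?size_iota // => i lti.
  by rewrite (nth_map 0) ?size_iota // nth_iota // nth_nil subn0.
by [].
Qed.

Lemma hook_shape la : is_partition la -> 0 < sumn la -> (1, 1) \notin cells la [::] ->
  la = head 0 la :: nseq (size la).-1 1 /\ 0 < head 0 la.
Proof.
case: la => // a la lap _; rewrite mem_straight /= -leqNgt => le1.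
have [_ /= /andP[a0 /allP pos]] := andP lap; split=> //; congr cons.
apply: (@eq_from_nth _ 0); rewrite ?size_nseq // => i lti; rewrite nth_nseq lti.
have := pos _ (mem_nth 0 lti); have := partition_nth (i := 1) (j := i.+1) lap isT.
by rewrite /=; lia.
Qed.

Lemma hook_des_count la n (J : {set 'I_n}) : 1 < n -> is_partition la -> sumn la = n ->
  (1, 1) \notin cells la [::] -> J \subset nm1 n ->
  des_count la [::] J = (#|J| == (size la).-1).
Proof.
move=> n1 lap sla nla sJ; have [e p] : la = head 0 la :: nseq (size la).-1 1 /\ 0 < head 0 la.
  by apply: hook_shape; rewrite // sla ltnW.
rewrite [in LHS]e (@hook_like_des_count (head 0 la) (size la).-1 0) //; first by rewrite addn0.
- exact: ltnW n1.
by rewrite subn0 -sla [in RHS]e /= sumn_nseq mul1n.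
Qed.

Section TwoPieces.
Variables (n k : nat).
Hypotheses (k_gt0 : 0 < k) (k_lt : k < n).
Notation la := ((n - k).+1 :: nseq k 1).

Lemma two_pieces_nth i : nth 0 [:: 1] i.+1 = 0. Proof. by case: i. Qed.

(** The two summands of [hook_like_des_count] are the values at [J] and at [J] with the last index
    added. *)
Lemma two_pieces_lift : cyclic_lift (@des_count n la [:: 1]) (fun J => #|J| == k).
Proof.
have n0 : 0 < n by apply: leq_ltn_trans k_lt.
split=> [J|J sJ||]; rewrite ?card_shift1 //.
- rewrite (@hook_like_des_count (n - k).+1 k 1) //; [|exact: two_pieces_nth|lia].
  have lt : n.-1 < n by rewrite prednK.
  have kE : (Ordinal lt).+1 = n by rewrite /= prednK.
  rewrite (setC_nm1 kE) cardsU1 (_ : _ \notin J) ?add1n //.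
  by apply/negP => /(subsetP sJ); rewrite inE kE ltnn.
- by rewrite cards0; case: (k) k_gt0.
- by rewrite cardsT card_ord; move: k_lt; clear; case: eqP => //; lia.
Qed.

Lemma two_pieces_skew : Defs.is_skew la [:: 1].
Proof.
rewrite /Defs.is_skew /subshape /is_partition /= size_nseq.
apply/andP; split.
  apply/andP; split; last by rewrite all_nseq orbT.
  by case: (k) k_lt => //= j lt; elim: (j).
apply/allP => i; rewrite mem_iota; case: i => // i; rewrite add1n => lti /=.
by case: (i) => //.
Qed.

Lemma two_pieces_size : size (cells la [:: 1]) = n.
Proof.
have e : perm_eq (cells la [:: 1]) (arm_cells (n - k).+1 1 ++ leg_cells k).
  apply: uniq_perm; rewrite ?uniq_cells ?uniq_arm_leg // => c.
  by apply: mem_hook_like => //; apply: two_pieces_nth.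
by rewrite (perm_size e) size_cat !size_map !size_iota subSS subn0 subnK // ltnW.
Qed.

Lemma two_pieces_not_ribbon : ~ connected_ribbon la [:: 1].
Proof.
have memE : cells la [:: 1] =i arm_cells (n - k).+1 1 ++ leg_cells k.
  by move=> c; apply: mem_hook_like => //; apply: two_pieces_nth.
case=> /(_ (fun c => c.1 == 0)) conn _; case: conn.
- apply/hasP; exists (0, 1) => //; rewrite memE mem_cat; apply/orP; left.
  by apply/mapP; exists 1; rewrite // mem_iota; move: k_lt; clear; lia.
- apply/hasP; exists (1, 0) => //; rewrite memE mem_cat; apply/orP; right.
  by apply/mapP; exists 0; rewrite // mem_iota; move: k_gt0; clear; lia.
move=> c [d []]; rewrite !memE !mem_cat => /orP[]/mapP[j]; rewrite mem_iota => hj -> //.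
case/orP=> /mapP[i]; rewrite mem_iota => hi -> //.
rewrite /adjacent /= => + _ _; move: hj; clear; lia.
Qed.
End TwoPieces.

(** * Coefficients of fundamental quasisymmetric and Schur polynomials *)

Lemma perm_mnm n (s t : seq 'I_n) :
  ((\sum_(i <- s) U_(i))%MM == (\sum_(i <- t) U_(i))%MM) = perm_eq s t.
Proof.
have cE (r : seq 'I_n) v : (\sum_(i <- r) U_(i))%MM v = count_mem v r.
  by elim: r => [|i r IH]; rewrite ?big_nil ?mnm0E // big_cons mnmDE mnm1E IH.
apply/eqP/idP => [/mnmP e|/seq.permP e].
  by apply/allP => v _; rewrite /= -!cE e.
by apply/mnmP => v; rewrite !cE.
Qed.

Section Cuts.
Variables (n : nat) (J : {set 'I_n.+1}).
Hypothesis sJ : J \subset nm1 n.+1.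

(* The weakly increasing word whose rises are exactly at [J]; its content is the
   monomial at which [Fund D] has coefficient [D \subset J]. *)
Definition cuts (j : nat) : 'I_n.+1 := inord #|[set i in J | i < j]|.

(** [inord] does not truncate: [J] avoids the last index, so at most [n] of the [n.+1] indices are
    counted. This is why n.+1 variables suffice to see every descent set. *)
Lemma cutsE j : cuts j = #|[set i in J | i < j]| :> nat.
Proof.
rewrite inordK // ltnS.
have cn : #|[set~ (@ord_max n)]| = n by rewrite cardsC1 card_ord.
rewrite -[leqRHS]cn; apply/subset_leq_card/subsetP => i; rewrite !inE => /andP[iJ _].
by apply/eqP=> e; have := subsetP sJ i iJ; rewrite e inE ltnn.
Qed.

Lemma cuts_mono j k : j <= k -> cuts j <= cuts k.
Proof.
move=> le; rewrite !cutsE; apply/subset_leq_card/subsetP=> i; rewrite !inE.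
by move=> /andP[-> /= /leq_trans->].
Qed.

Lemma cutsS (i : 'I_n.+1) : cuts i.+1 = (i \in J) + cuts i :> nat.
Proof.
rewrite !cutsE; have [iJ|iJ] /= := boolP (i \in J); last first.
  apply: eq_card => k; rewrite !inE ltnS leq_eqVlt; case: eqP => // /val_inj ->.
  by rewrite (negbTE iJ).
rewrite (_ : [set k in J | k < i.+1] = i |: [set k in J | k < i]) ?cardsU1 ?inE ?ltnn ?andbF //.
by apply/setP => k; rewrite !inE ltnS leq_eqVlt -val_eqE; case: eqP => //= /val_inj ->; rewrite iJ.
Qed.

Lemma cuts_lt p q (i : 'I_n.+1) : i \in J -> p <= i < q -> cuts p < cuts q.
Proof.
move=> iJ /andP[le lt]; apply: leq_trans (cuts_mono lt).
by rewrite cutsS iJ ltnS cuts_mono.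
Qed.

Definition cut_seq : seq 'I_n.+1 := [seq cuts j | j <- iota 0 n.+1].

Lemma sorted_cut_seq : sorted (relpre val leq) cut_seq.
Proof.
apply/(sortedP ord0) => i; rewrite size_map size_iota => lti.
by rewrite !(nth_map 0) ?size_iota ?nth_iota ?(ltnW lti) //= cuts_mono.
Qed.

Lemma sorted_cut_seqE (s : seq 'I_n.+1) :
  sorted (relpre val leq) s -> perm_eq s cut_seq -> s = cut_seq.
Proof.
move=> ss; apply: (sorted_eq (leT := relpre val leq)) ss sorted_cut_seq.
  by move=> y x z /=; apply: leq_trans.
by move=> x y /= le; apply/val_inj/anti_leq.
Qed.

Definition cut_mnm : 'X_{1..n.+1} := (\sum_(i <- cut_seq) U_(i))%MM.

Lemma coef_sum_X (I : finType) N (P : pred I) (t : I -> 'I_N -> 'I_n.+1) :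
  ((\sum_(x | P x) \prod_(k < N) 'X_(t x k) : {mpoly int[n.+1]})@_cut_mnm)%R =
  (#|[set x | P x & perm_eq [seq t x k | k <- enum 'I_N] cut_seq]|%:R)%R.
Proof.
rewrite raddf_sum /= -sum1_card natr_sum big_mkcond [RHS]big_mkcond /=.
apply: eq_bigr => x _; rewrite inE; case: (P x) => //=.
rewrite mprodXE mcoeffX /cut_mnm.
have -> : (\sum_(i < N) U_(t x i))%MM = (\sum_(i <- [seq t x k | k <- enum 'I_N]) U_(i))%MM.
  by rewrite big_map big_enum.
by rewrite perm_mnm; case: ifP.
Qed.

Lemma cut_seqE : cut_seq = [seq cuts k | k : 'I_n.+1 <- enum 'I_n.+1].
Proof. by rewrite /cut_seq -val_enum_ord -map_comp. Qed.

(** The only weakly increasing word with this content is [cuts] itself. It rises exactly at [J], so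
    it is admissible for [D] exactly when [D] is contained in [J]. *)
Lemma coef_Fund (D : {set 'I_n.+1}) : D \subset nm1 n.+1 ->
  ((Fund D)@_cut_mnm)%R = ((D \subset J)%:R)%R.
Proof.
move=> sD; rewrite /Fund coef_sum_X; congr (_ %:R)%R.
rewrite (_ : [set x | _ & _] = if D \subset J then [set [ffun k : 'I_n.+1 => cuts k]] else set0).
  by case: ifP; rewrite ?cards1 ?cards0.
have ordSE (j : 'I_n.+1) : j < n -> ordS j = j.+1 :> nat.
  by move=> lt; rewrite /= modn_small.
apply/setP => x; rewrite inE.
have xE : [forall j : 'I_n.+1, (j.+1 < n.+1) ==> (if j \in D then x j < x (ordS j) else x j <= x (ordS j))] ->
   perm_eq [seq x k | k <- enum 'I_n.+1] cut_seq -> x = [ffun k : 'I_n.+1 => cuts k].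
  move=> /forallP h /sorted_cut_seqE e.
  have {}e : [seq x k | k <- enum 'I_n.+1] = cut_seq.
    apply: e; apply/(sortedP ord0) => i; rewrite size_map size_enum_ord => lti.
    have nthx p : p < n.+1 -> nth ord0 [seq x k | k <- enum 'I_n.+1] p = x (inord p).
      move=> lt; rewrite (nth_map ord0) ?size_enum_ord //; congr (x _).
      by apply/ord_inj; rewrite nth_enum_ord // inordK.
    rewrite !nthx ?(ltnW lti) // /=; have := h (inord i); rewrite inordK ?(ltnW lti) // lti /=.
    have -> : ordS (inord i : 'I_n.+1) = inord i.+1.
      by apply/ord_inj; rewrite ordSE !inordK ?(ltnW lti).
    by case: ifP => // _ /ltnW.
  move: e; rewrite cut_seqE => /eq_in_map e; apply/ffunP=> k; rewrite ffunE e //.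
  by rewrite mem_enum.
apply/andP/idP => [[h p]|].
  have e := xE h p; have -> : D \subset J; last by rewrite inE e.
  apply/subsetP => i iD; have := subsetP sD i iD; rewrite inE => lti.
  have := forallP h i; rewrite lti iD /= e !ffunE ordSE // cutsS.
  by case: (i \in J) => //; rewrite add0n ltnn.
case: ifP => [sDJ|]; rewrite inE // => /eqP ->; split; last first.
  by rewrite cut_seqE (eq_map (_ : _ =1 (fun k : 'I_n.+1 => cuts k))) // => k; rewrite ffunE.
apply/forallP => j; apply/implyP => ltj; rewrite !ffunE ordSE // cutsS.
by case: ifP => [/(subsetP sDJ) ->|_]; rewrite ?leq_addl.
Qed.
End Cuts.

Lemma rise_between (f : nat -> nat) p q : p <= q -> f p < f q ->
  exists2 i, p <= i < q & f i < f i.+1.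
Proof.
elim: q => [|q IH]; first by rewrite leqn0 => /eqP ->; rewrite ltnn.
rewrite leq_eqVlt => /orP[/eqP ->|]; first by rewrite ltnn.
rewrite ltnS => le lt; have [le'|lt'] := leqP (f q.+1) (f q).
  by have [i /andP[pi iq] fi] := IH le (leq_trans lt le'); exists i; rewrite // pi ltnS ltnW.
by exists q; rewrite // le ltnSn.
Qed.

Section Standardization.
Variables (n : nat) (J : {set 'I_n.+1}) (la : seq nat).
Hypothesis sJ : J \subset nm1 n.+1.
Hypothesis la_part : is_partition la.
Notation Y := (cells la [::]).
Notation X := (SYT la [::]).
Notation N := (size Y).
Hypothesis szY : N = n.+1.
Notation filling := {ffun 'I_N -> 'I_n.+1}.

Definition entry (t : filling) (c : cell) : nat :=
  nth 0 [seq val (t k) | k <- enum 'I_N] (index c Y).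

Lemma entryE t (k : 'I_N) : entry t (nth (0, 0) Y k) = t k.
Proof.
rewrite /entry index_uniq ?uniq_cells // (nth_map k) ?size_enum_ord //.
by rewrite nth_ord_enum.
Qed.

Lemma cellP (c : cell) : c \in Y -> exists k : 'I_N, c = nth (0, 0) Y k.
Proof. by rewrite -index_mem => lt; exists (Ordinal lt); rewrite nth_index // -index_mem. Qed.

Lemma map_entry t : [seq entry t c | c <- Y] = [seq val (t k) | k <- enum 'I_N].
Proof.
apply: (@eq_from_nth _ 0); first by rewrite !size_map -enumT size_enum_ord.
by move=> i; rewrite size_map => lti; rewrite (nth_map (0, 0)) // /entry index_uniq ?uniq_cells.
Qed.

Lemma SSYT_P (t : filling) : reflect
  (forall c d : cell, c \in Y -> d \in Y ->
     (d = rightc c -> entry t c <= entry t d) /\ (d = downc c -> entry t c < entry t d))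
  (is_SSYT t).
Proof.
apply: (iffP forallP) => [h c d /cellP[k ->] /cellP[l ->]|h k].
  have /forallP/(_ l) /= := h k.
  rewrite -[(0%R, 0%R)]/(0, 0) => /andP[/implyP h1 /implyP h2].
  by rewrite !entryE; split=> e; [apply: h1 | apply: h2]; apply/eqP.
apply/forallP => l; rewrite /= -[(0%R, 0%R)]/(0, 0).
have [||h1 h2] := h (nth (0, 0) Y k) (nth (0, 0) Y l); rewrite ?mem_nth //.
by move: h1 h2; rewrite !entryE => h1 h2; apply/andP; split; apply/implyP => /eqP.
Qed.

Lemma SSYT_mono t (c d : cell) : is_SSYT t -> d \in Y -> c.1 <= d.1 -> c.2 <= d.2 ->
  entry t c + (c.1 < d.1) <= entry t d.
Proof.
move=> /SSYT_P tS dY; have [m] := ubnP (d.1 - c.1 + (d.2 - c.2)).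
elim: m c => // m IH c lem le1 le2; have cY := straight_closed la_part dY le1 le2.
have [lt1|ge1] := ltnP c.1 d.1.
  have c'Y : downc c \in Y by apply: straight_closed dY _ _.
  have := IH (downc c); have := (tS _ _ cY c'Y).2 erefl; move: lem lt1 le2 => /=; clear.
  move=> h1 h2 h3 h4 h5; have := h5 _ h2 h3; case: (_ < d.1); lia.
have e1 : c.1 = d.1 by apply/eqP; rewrite eqn_leq le1.
have [lt2|ge2] := ltnP c.2 d.2; last first.
  have -> : c = d by rewrite [c]surjective_pairing [d]surjective_pairing e1; congr pair; apply/eqP; rewrite eqn_leq le2.
  by rewrite addn0.
have c'Y : rightc c \in Y by apply: straight_closed dY _ _.
have := IH (rightc c); have := (tS _ _ cY c'Y).1 erefl; move: lem le1 ge1 lt2 => /=; clear.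
move=> h1 h2 h2' h3 h4 h5; have := h5 _ h2 h3; lia.
Qed.

(** The inverse of standardization: the entry at position [p] is weakened to the letter
    [cuts J p]. *)
Definition fill (T : seq cell) : filling := [ffun k : 'I_N => cuts J (index (nth (0, 0) Y k) T)].

Lemma entry_fill T (c : cell) : c \in Y -> entry (fill T) c = cuts J (index c T).
Proof. by move=> /cellP[k ->]; rewrite entryE ffunE. Qed.

(* Standardization reads equal entries from left to right. *)
Definition before t (c d : cell) : bool :=
  (entry t c < entry t d) || ((entry t c == entry t d) && (c.2 <= d.2)).
Definition sbefore t (c d : cell) : bool :=
  (entry t c < entry t d) || ((entry t c == entry t d) && (c.2 < d.2)).

Lemma content_fill (t : filling) (T : seq cell) : perm_eq T Y ->
  perm_eq [seq t k | k <- enum 'I_N] (cut_seq J) =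
  perm_eq [seq entry t c | c <- T] [seq val v | v <- cut_seq J].
Proof.
move=> pT; rewrite (permPl (perm_map (entry t) pT)) map_entry.
rewrite (map_comp val (fun k => t k)); apply/idP/idP => [|h]; first exact: perm_map.
by apply: perm_map_inj h; apply: val_inj.
Qed.

(** For strictness down a column: between a cell and the one below it the row index must rise
    somewhere, at a descent of [T], hence at an element of [J], where [cuts] jumps. *)
Lemma fill_SSYT T : T \in X -> DesT n.+1 T \subset J ->
  is_SSYT (fill T) && perm_eq [seq fill T k | k <- enum 'I_N] (cut_seq J).
Proof.
move=> TX sD; have sT : size T = n.+1 by rewrite (SYT_size TX).
have uT := SYT_uniq TX.
apply/andP; split; last first.
  rewrite (content_fill _ (SYT_perm TX)) (_ : [seq entry _ c | c <- T] = [seq val v | v <- cut_seq J]) //.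
  apply: (@eq_from_nth _ 0); rewrite ?size_map ?size_iota ?sT // => i lti.
  rewrite (nth_map (0, 0)) ?sT // entry_fill; last by rewrite -(SYT_mem TX) mem_nth ?sT.
  by rewrite index_uniq ?sT // (nth_map ord0) ?size_map ?size_iota // (nth_map 0) ?size_iota // nth_iota.
apply/SSYT_P => c d cY dY; rewrite !entry_fill //; split=> e.
  by apply: cuts_mono => //; apply/ltnW/(SYT_next TX) => //; rewrite e /next_to eqxx.
have lt : index c T < index d T by apply: (SYT_next TX) => //; rewrite e /next_to eqxx orbT.
have dT : d \in T by rewrite (SYT_mem TX).
have cT : c \in T by rewrite (SYT_mem TX).
have [] := @rise_between (fun i => (nth (0, 0) T i).1) (index c T) (index d T) (ltnW lt).
  by rewrite !nth_index // e.
move=> i /andP[ci id] ri; have dn : index d T < n.+1 by rewrite -sT index_mem.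
have lti : i < n.+1 by apply: ltn_trans dn.
apply: (cuts_lt sJ (i := Ordinal lti)); last by rewrite /= ci id.
by apply: (subsetP sD); rewrite inE /= ri (leq_ltn_trans id dn).
Qed.

(** Equal consecutive letters mean no descent, so the next cell lies strictly to the right. Hence
    the filling determines the order of the cells in [T]. *)
Lemma fill_sorted T : T \in X -> DesT n.+1 T \subset J -> sorted (sbefore (fill T)) T.
Proof.
move=> TX sD; have sT : size T = n.+1 by rewrite (SYT_size TX).
have uT := SYT_uniq TX.
apply/(sortedP (0, 0)) => i; rewrite sT => lti; have lti' := ltnW lti.
have atY p : p < n.+1 -> nth (0, 0) T p \in Y by rewrite -(SYT_mem TX) -sT; apply: mem_nth.
rewrite /sbefore !entry_fill ?atY // !index_uniq ?sT //.
have cS := cutsS sJ (Ordinal lti'); rewrite /= in cS; rewrite cS.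
case: (boolP (Ordinal lti' \in J)) => iJ /=; first by rewrite ltnS leqnn.
rewrite add0n ltnn eqxx /=; apply: (at_nle la_part TX) => //; first by rewrite sT.
rewrite leqNgt; apply: contra iJ => r; apply: (subsetP sD); rewrite inE /= lti; exact: r.
Qed.

Lemma fill_inj T T' : T \in X -> DesT n.+1 T \subset J -> T' \in X -> DesT n.+1 T' \subset J ->
  fill T = fill T' -> T = T'.
Proof.
move=> TX sD T'X sD' e; have := fill_sorted TX sD; have := fill_sorted T'X sD'; rewrite -e => s' s.
apply: irr_sorted_eq s s' _; last by move=> c; rewrite (SYT_mem TX) (SYT_mem T'X).
  by move=> y x z; rewrite /sbefore; lia.
by move=> x; rewrite /sbefore; lia.
Qed.

(** Sorting the cells by [before] is standardization. A descent outside [J] would give two equal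
    letters, the second strictly lower and weakly to the right, against semistandardness. *)
Lemma fill_surj (t : filling) : is_SSYT t -> perm_eq [seq t k | k <- enum 'I_N] (cut_seq J) ->
  exists2 T, (T \in X) && (DesT n.+1 T \subset J) & t = fill T.
Proof.
move=> tS tc; pose T := sort (before t) Y.
have pT : perm_eq T Y by rewrite perm_sort.
have uT : uniq T by rewrite (perm_uniq pT) uniq_cells.
have sT : size T = n.+1 by rewrite (perm_size pT).
have bT : transitive (before t) by move=> y x z; rewrite /before; lia.
have srt : sorted (before t) T by apply: sort_sorted => x y; rewrite /before; lia.
have ltT (c d : cell) : c \in Y -> d \in Y -> ~~ before t d c -> index c T < index d T.
  rewrite -!(perm_mem pT) => cT dT nb; rewrite ltnNge; apply: contra nb => le.
  rewrite -(nth_index (0, 0) dT) -(nth_index (0, 0) cT).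
  by apply: (sorted_leq_nth bT _ (0, 0) srt); rewrite ?inE ?index_mem // => x; rewrite /before; lia.
have TX : T \in X.
  apply/SYT_P; split=> // c d cY dY /orP[] /eqP e; apply: ltT => //; rewrite /before.
    by have := ((SSYT_P t tS) c d cY dY).1 e; rewrite e /=; lia.
  by have := ((SSYT_P t tS) c d cY dY).2 e; lia.
have eT : [seq entry t c | c <- T] = [seq val v | v <- cut_seq J].
  apply: (sorted_eq (leT := leq)); [exact: leq_trans|exact: anti_leq| | |].
  - rewrite sorted_map; apply: sub_sorted srt => x y; rewrite /before /=; lia.
  - by rewrite sorted_map; apply: sorted_cut_seq.
  - by rewrite -content_fill.
have eat i : i < n.+1 -> entry t (nth (0, 0) T i) = cuts J i.
  move=> lti; have := congr1 (fun s => nth 0 s i) eT; rewrite (nth_map (0, 0)) ?sT // => ->.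
  by rewrite (nth_map ord0) ?size_map ?size_iota // (nth_map 0) ?size_iota // nth_iota.
exists T; last first.
  apply/ffunP=> k; rewrite ffunE; apply: val_inj; rewrite /= -entryE -eat.
    by rewrite nth_index // (perm_mem pT) mem_nth.
  by rewrite -sT index_mem (perm_mem pT) mem_nth.
rewrite TX; apply/subsetP => i; rewrite inE => /andP[lti r]; apply: contraT => iJ.
have e : entry t (nth (0, 0) T i) = entry t (nth (0, 0) T i.+1).
  by rewrite !eat // (cutsS sJ) (negbTE iJ).
have := sortedP (0, 0) srt i; rewrite sT => /(_ lti); rewrite /before e ltnn eqxx /= => le2.
have dY : nth (0, 0) T i.+1 \in Y by rewrite -(perm_mem pT) mem_nth ?sT.
by have := SSYT_mono tS dY (ltnW r) le2; rewrite e r addn1 ltnn.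
Qed.

Lemma coef_schur : ((schur n.+1 la)@_(cut_mnm J))%R =
  ((count (fun T => DesT n.+1 T \subset J) X)%:R)%R.
Proof.
rewrite /schur coef_sum_X; congr (_ %:R)%R.
pose L := [seq T <- X | DesT n.+1 T \subset J].
have uL : uniq [seq fill T | T <- L].
  rewrite map_inj_in_uniq => [|T T']; first exact/filter_uniq/uniq_SYT.
  rewrite mem_filter => /andP[sD TX]; rewrite mem_filter => /andP[sD' TX'].
  exact: fill_inj TX sD TX' sD'.
rewrite -size_filter -(size_map fill L) -(card_uniqP uL); apply: eq_card => t.
rewrite inE; apply/andP/mapP => [[tS tc]|[T]].
  have [T /andP[TX sD] e] := fill_surj tS tc; exists T => //.
  by rewrite mem_filter sD.
by rewrite mem_filter => /andP[sD TX] ->; apply/andP; apply: fill_SSYT.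
Qed.
End Standardization.

(** * Rotation of permutations *)

Lemma count_subset (U : Type) (I : finType) (f : U -> {set I}) s (J : {set I}) :
  count (fun x => f x \subset J) s =
  \sum_(K : {set I} | K \subset J) count (fun x => f x == K) s.
Proof.
elim: s => [|x s IH] /=; first by rewrite big1.
rewrite big_split /= IH; congr (_ + _); case: (boolP (f x \subset J)) => h.
  by rewrite (bigD1 (f x)) //= eqxx big1 // => K /andP[_ /negbTE]; rewrite eq_sym => ->.
by rewrite big1 // => K sK; case: eqP => // e; rewrite e sK in h.
Qed.

(** Uniqueness in Möbius inversion: once the values on proper subsets agree, they cancel from both
    sums. *)
Lemma subset_sum_inj (I : finType) (B : {set I}) (f g : {set I} -> nat) :
  (forall J : {set I}, J \subset B ->
     \sum_(K : {set I} | K \subset J) f K = \sum_(K : {set I} | K \subset J) g K) ->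
  forall J : {set I}, J \subset B -> f J = g J.
Proof.
move=> h J; have [m] := ubnP #|J|; elim: m J => // m IH J ltm sJ.
have := h J sJ; rewrite (bigD1 J) // [in RHS](bigD1 J) //=.
rewrite (eq_bigr g) => [/addIn //|K /andP[sK nK]]; apply: IH; last exact: subset_trans sJ.
have : K \proper J by rewrite properEneq nK.
by move/proper_card => lt; apply: leq_trans lt _.
Qed.

Lemma Des_sub n (s : 'S_n) : Des s \subset nm1 n.
Proof. by apply/subsetP => i; rewrite !inE => /andP[]. Qed.

(** Comparing coefficients at [cut_mnm J] equates the numbers of objects whose descent set lies
    inside [J]; inversion over subsets gives the exact counts. *)
Lemma schur_expansion_des n (A : {set 'S_n}) (L : seq (seq nat)) (J : {set 'I_n}) : 0 < n ->
  all (fun la => is_partition la && (sumn la == n)) L ->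
  (\sum_(s in A) Fund (Des s) = \sum_(la <- L) schur n la)%R -> J \subset nm1 n ->
  count (fun s => Des s == J) (enum A) = \sum_(la <- L) des_count la [::] J.
Proof.
case: n A J => // n A J _ /allP Lp QE; move: J.
apply: (subset_sum_inj (g := fun J => \sum_(la <- L) des_count la [::] J)) => J sJ.
rewrite exchange_big /= -count_subset.
rewrite (eq_bigr (fun la => count (fun T => DesT n.+1 T \subset J) (SYT la [::]))) => [|la _]; last first.
  by rewrite -count_subset.
have := congr1 (mcoeff (cut_mnm J)) QE; rewrite !raddf_sum /=.
rewrite (eq_bigr (fun s => ((Des s \subset J : nat)%:R)%R)) => [|s _]; last first.
  by rewrite coef_Fund // Des_sub.
rewrite [X in _ = X -> _]big_seq (eq_bigr (fun la => ((count (fun T => DesT n.+1 T \subset J) (SYT la [::]))%:R)%R)) => [|la laL]; last first.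
  have /andP[lap /eqP sla] := Lp _ laL; rewrite coef_schur // size_straight //.
rewrite -big_seq -!natr_sum => /eqP; rewrite eqr_nat => /eqP <-.
by rewrite -big_enum /= -sum1_count [LHS]big_mkcond.
Qed.

Section Rotation.
Variable n : nat.
Hypothesis n_gt1 : 1 < n.

Lemma shift1_cDesP (s : 'S_n) : shift1 (cDesP (cn n * s)%g) = cDesP s.
Proof.
apply/setP => i; rewrite -(ord_predK i) mem_shift1 !inE.
by rewrite !permM !permE.
Qed.

Lemma cDesP_nm1 (s : 'S_n) : cDesP s :&: nm1 n = Des s.
Proof. by apply/setP => i; rewrite !inE andbC. Qed.

Lemma cDesP_neq0 (s : 'S_n) : cDesP s != set0.
Proof.
have ltm : n.-1 < n by rewrite prednK // ltnW.
(* The position of the largest value is a cyclic descent, as its cyclic successor is a different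
   position for [1 < n]. Dually, the position of the least value never is one. *)
pose i := (s^-1)%g (Ordinal ltm); apply/set0Pn; exists i; rewrite inE permKV /=.
rewrite ltn_neqAle -ltnS prednK ?ltn_ord ?andbT; last exact: ltnW.
apply/eqP => e; have : s (ordS i) = s i by apply: val_inj; rewrite /= permKV.
move/perm_inj/(congr1 val) => /=; have [lt|ge] := ltnP i.+1 n.
  by rewrite modn_small //; lia.
have -> : i.+1 = n by apply/eqP; rewrite eqn_leq ge ltn_ord.
by rewrite modnn => e0; rewrite -e0 in ge; move: ge n_gt1; clear; lia.
Qed.

Lemma cDesP_neqT (s : 'S_n) : cDesP s != setT.
Proof.
have lt0 : 0 < n by apply: ltnW.
apply/eqP/setP => /(_ ((s^-1)%g (Ordinal lt0))).
by rewrite !inE permKV /= ltn0.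
Qed.

Lemma split_last (J K : {set 'I_n}) : J \subset nm1 n ->
  (K == J) + (K == ~: nm1 n :|: J) = (K :&: nm1 n == J).
Proof.
move=> sJ; have ltm : n.-1 < n by rewrite prednK // ltnW.
pose k := Ordinal ltm; have ek : k.+1 = n by rewrite /= prednK // ltnW.
have kn (S : {set 'I_n}) : k \notin S :&: nm1 n by rewrite !inE ek ltnn andbF.
have kJ : k \notin J by rewrite -(setIidPl sJ).
have KE : K = if k \in K then k |: (K :&: nm1 n) else K :&: nm1 n.
  apply/setP => i; have [->|ik] := eqVneq i k.
    by case: ifP => // kK; rewrite ?setU11 // (negbTE (kn _)).
  have in1 : i \in nm1 n by rewrite -[nm1 n]setCK (setC_nm1 ek) !inE.
  by case: ifP => _; rewrite !inE ?(negbTE ik) /=; move: in1; rewrite inE => ->; rewrite andbT.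
rewrite (setC_nm1 ek); case: (boolP (k \in K)) KE => kK KE.
  have -> : (K == J) = false by apply/eqP => e; rewrite -e kK in kJ.
  rewrite add0n; congr nat_of_bool; apply/eqP/eqP => [->|e]; last by rewrite KE e.
  by rewrite setIUl (setIidPl sJ) -(setC_nm1 ek) setIC setICr set0U.
have -> : (K == k |: J) = false by apply/eqP => e; rewrite e setU11 in kK.
by rewrite addn0 -KE.
Qed.

(** Composition with [cn] permutes [A] and rotates cyclic descent sets by one step, which gives the
    invariance of their counts. *)
Lemma rotation_lift (A : {set 'S_n}) : rotA A = A ->
  cyclic_lift (fun J : {set 'I_n} => count (fun s : 'S_n => Des s == J) (enum A))
              (fun J : {set 'I_n} => count (fun s : 'S_n => cDesP s == J) (enum A)).
Proof.
move=> rA; split=> [J|J sJ||].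
- have pA : perm_eq (enum A) [seq (cn n * s)%g | s <- enum A].
    apply: uniq_perm; rewrite ?map_inj_uniq ?enum_uniq //; first exact: mulgI.
    move=> s; rewrite mem_enum -{1}rA; apply/imsetP/mapP => -[t tA ->]; exists t => //.
      by rewrite mem_enum.
    by rewrite mem_enum in tA.
  rewrite [RHS](seq.permP pA) count_map; apply: eq_count => s /=.
  by rewrite -(shift1_cDesP s) (iter_shift1_eq 1).
- elim: (enum A) => //= s r IH; rewrite -IH -cDesP_nm1 -(split_last _ sJ).
  by move: (_ == _) (_ == _) => b1 b2; clear; lia.
- by apply/eqP; rewrite eqn0Ngt -has_count; apply/hasPn => s _; apply: cDesP_neq0.
- by apply/eqP; rewrite eqn0Ngt -has_count; apply/hasPn => s _; apply: cDesP_neqT.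
Qed.

(** Rotating any [k] outside [J] to the last index gives the value at [k |: J] as [h #|J| - e J], so
    [e] is determined by its value at the empty set and the number of elements added. *)
Lemma depends_on_card (R : zmodType) (e : {set 'I_n} -> R) (h : nat -> R) :
  (forall J : {set 'I_n}, e (shift1 J) = e J) ->
  (forall J : {set 'I_n}, J \subset nm1 n -> (e J + e (~: nm1 n :|: J) = h #|J|)%R) ->
  forall J K : {set 'I_n}, #|J| = #|K| -> e J = e K.
Proof.
move=> eS eh; have ltm : n.-1 < n by rewrite prednK // ltnW.
pose k0 := Ordinal ltm; have ek0 : k0.+1 = n by rewrite /= prednK // ltnW.
have rec k (J : {set 'I_n}) : k \notin J -> (e (k |: J) = h #|J| - e J)%R.
  move=> kJ; pose r := iter (n.-1 - k) (@shift1 n).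
  have er (S : {set 'I_n}) : e (r S) = e S by rewrite /r; elim: (n.-1 - k) => //= p IH; rewrite eS.
  have kr : iter (n.-1 - k) (@ordS n) k = k0.
    apply: val_inj; rewrite val_iter_ordS /= subnKC ?modn_small //.
    by rewrite -ltnS prednK // ltnW.
  have rU : r (k |: J) = k0 |: r J.
    rewrite -kr /r; elim: (n.-1 - k) => //= p IH; by rewrite IH shift1U1.
  have crd : #|r J| = #|J| by rewrite /r; elim: (n.-1 - k) => //= p IH; rewrite card_shift1.
  have sr : r J \subset nm1 n.
    rewrite -[nm1 n]setCK (setC_nm1 ek0) subsetC sub1set inE -kr mem_iter_shift1 //.
  by rewrite -er rU -(setC_nm1 ek0) -(er J) -crd -(eh _ sr) addrC addKr.
move=> J K; have [m] := ubnP #|J|; elim: m J K => // m IH J K ltm' c.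
have [J0|[j jJ]] := set_0Vmem J.
  by move: c; rewrite J0 cards0 => /esym/eqP; rewrite cards_eq0 => /eqP ->.
have [K0|[k kK]] := set_0Vmem K.
  by move: c; rewrite K0 cards0 => /eqP; rewrite cards_eq0 => /eqP J0; rewrite J0 inE in jJ.
have c' : #|J :\ j| = #|K :\ k| by move: c; rewrite (cardsD1 j) (cardsD1 k K) jJ kK => -[].
rewrite -(setD1K jJ) -(setD1K kK) !rec ?inE ?eqxx // c' (IH (J :\ j) (K :\ k)) //.
by move: ltm'; rewrite (cardsD1 j) jJ.
Qed.
End Rotation.

(** Choice along a finite list, used to fix one lift for every non-hook shape in the Schur
    expansion. *)
Lemma seq_choice (U : eqType) (V : Type) (v0 : V) (P : U -> V -> Prop) (s : seq U) :
  {in s, forall x, exists v, P x v} -> exists f, {in s, forall x, P x (f x)}.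
Proof.
elim: s => [|x s IH] h; first by exists (fun=> v0).
have [y|f fP] := IH; first by move=> ys; apply: h; rewrite inE ys orbT.
have [v Pv] := h x (mem_head _ _).
exists (fun y => if y == x then v else f y) => y; rewrite inE.
by case: eqP => [->|] //= _ /fP.
Qed.

Lemma sum_by_value (R : zmodType) (U : Type) (I : finType) (F : I -> R) (f : U -> I) s :
  (\sum_(x <- s) F (f x) = \sum_i F i *+ count (fun x => f x == i) s)%R.
Proof.
elim: s => [|x s IH]; first by rewrite big_nil big1 // => i _; rewrite mulr0n.
rewrite big_cons IH /= [RHS](eq_bigr (fun i => F i *+ (f x == i) + F i *+ count (fun x => f x == i) s)%R); last first.
  by move=> i _; rewrite mulrnDr.
rewrite big_split /=; congr (_ + _)%R.
rewrite (bigD1 (f x)) //= eqxx mulr1n big1 ?addr0 // => i; rewrite eq_sym => /negbTE ->.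
by rewrite mulr0n.
Qed.

Lemma straight_skew la : is_partition la -> Defs.is_skew la [::].
Proof.
by move=> lap; rewrite /Defs.is_skew lap /subshape /=; apply/allP => i _; rewrite nth_nil.
Qed.

Lemma nonhook_not_ribbon la : is_partition la -> (1, 1) \in cells la [::] ->
  ~ connected_ribbon la [::].
Proof.
move=> lap has11 [_ /hasP[]]; have [h00 h01 h10] := straight11 lap has11.
by exists (0, 0) => //; apply/and3P.
Qed.

(** * Cyclic expansion of a rotation-invariant Schur-positive set *)

Section CyclicExpansion.
Variables (n : nat) (A : {set 'S_n}) (L : seq (seq nat)).
Hypothesis n_gt1 : 1 < n.
Hypothesis rotA_A : rotA A = A.
Hypothesis L_part : all (fun la => is_partition la && (sumn la == n)) L.
Hypothesis L_schur : (\sum_(s in A) Fund (Des s) = \sum_(la <- L) schur n la)%R.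

Notation nonhook := (fun la => (1, 1) \in cells la [::]).
Notation prefix p := [set i : 'I_n | i < p].
Notation cA := (fun J : {set 'I_n} => count (fun s : 'S_n => cDesP s == J) (enum A)).

Let partL la : la \in L -> is_partition la /\ sumn la = n.
Proof. by move/(allP L_part) => /andP[lap /eqP]. Qed.

Lemma nonhook_lifts : exists C : seq nat -> {set 'I_n} -> nat,
  {in [seq la <- L | nonhook la], forall la,
     cyclic_lift (@des_count n la [::]) (C la) /\ forall p, C la (prefix p) = 0}.
Proof.
apply: (@seq_choice _ ({set 'I_n} -> nat) (fun=> 0) (fun la c =>
  cyclic_lift (@des_count n la [::]) c /\ forall p, c (prefix p) = 0)) => la; rewrite mem_filter => /andP[has11 /partL[lap sla]].
have [|c c_lift c_pre] := nonhook_lift lap _ n_gt1 has11; first by rewrite size_straight.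
by exists c.
Qed.

Section WithLifts.
Variable C : seq nat -> {set 'I_n} -> nat.
Hypothesis C_lift : {in [seq la <- L | nonhook la], forall la,
     cyclic_lift (@des_count n la [::]) (C la) /\ forall p, C la (prefix p) = 0}.

Lemma cyclic_count (J : {set 'I_n}) :
  cA J = \sum_(la <- L | nonhook la) C la J + cA (prefix #|J|).
Proof.
(* The difference is formed in [int], because nothing yet says that the non-hook lifts stay below
   [cA]. *)
pose e (K : {set 'I_n}) : int :=
  ((cA K)%:R - (\sum_(la <- [seq la <- L | nonhook la]) C la K)%:R)%R.
pose h k : int := ((\sum_(la <- L | ~~ nonhook la) (k == (size la).-1))%:R)%R.
have [cS cE _ _] := rotation_lift n_gt1 rotA_A.
have n0 : 0 < n by apply: ltnW.
have eS K : e (shift1 K) = e K.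
  rewrite /e cS; congr (_ - _%:R)%R; apply: eq_big_seq => la laL.
  by have [[CS _ _ _] _] := C_lift laL; apply: CS.
have eh (K : {set 'I_n}) : K \subset nm1 n -> (e K + e (~: nm1 n :|: K) = h #|K|)%R.
  move=> sK; rewrite /e /h addrACA -opprD -!natrD cE //.
  rewrite (schur_expansion_des n0 L_part L_schur sK) -big_split /=.
  rewrite [X in (_ - X%:R)%R](eq_big_seq (fun la => des_count la [::] K)) => [|la laL]; last first.
    by have [[_ CE _ _] _] := C_lift laL; apply: CE.
  rewrite big_filter (bigID nonhook) /= natrD addrC addKr; congr (_%:R)%R.
  rewrite big_seq_cond [RHS]big_seq_cond; apply: eq_bigr => la /andP[/partL[lap sla] nla].
  exact: hook_des_count.
have cJ : #|J| = #|prefix #|J| | by rewrite card_ord_lt // -[leqRHS]card_ord max_card.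
have := depends_on_card n_gt1 eS eh cJ; rewrite /e.
rewrite [X in (_ = _ - X%:R)%R]big1_seq => [|la /andP[_ laL]]; last first.
  by have [_ ->] := C_lift laL.
rewrite subr0 big_filter => /eqP; rewrite subr_eq -natrD eqr_nat => /eqP ->.
by rewrite addnC.
Qed.

Definition two_pieces k : seq nat * seq nat := ((n - k).+1 :: nseq k 1, [:: 1]).

Definition shapes : seq (seq nat * seq nat) :=
  [seq (la, [::]) | la <- [seq la <- L | nonhook la]] ++
  flatten [seq nseq (cA (prefix k)) (two_pieces k) | k <- iota 1 n.-1].

(** An empty inner shape marks the non-hook partitions; for [two_pieces k] the number
    [(size sh.1).-1] is [k]. *)
Definition shape_lift (sh : seq nat * seq nat) (J : {set 'I_n}) : nat :=
  if sh.2 is [::] then C sh.1 J else #|J| == (size sh.1).-1.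

Lemma shapesP sh : sh \in shapes ->
  [/\ Defs.is_skew sh.1 sh.2, size (cells sh.1 sh.2) = n, ~ connected_ribbon sh.1 sh.2 &
      cyclic_lift (@des_count n sh.1 sh.2) (shape_lift sh)].
Proof.
rewrite mem_cat => /orP[/mapP[la laL ->]|/flatten_mapP[k]].
  have [lift _] := C_lift laL; move: laL; rewrite mem_filter => /andP[has11 /partL[lap sla]].
  split=> //=; [exact: straight_skew|by rewrite size_straight|exact: nonhook_not_ribbon].
rewrite mem_iota add1n prednK ?(ltnW n_gt1) // => /andP[k0 kn] /nseqP[-> _]; split=> /=.
- exact: two_pieces_skew.
- exact: two_pieces_size.
- exact: two_pieces_not_ribbon.
by rewrite /shape_lift /= size_nseq; apply: two_pieces_lift.
Qed.

Lemma shapes_count (J : {set 'I_n}) : cA J = \sum_(sh <- shapes) shape_lift sh J.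
Proof.
have [_ _ c0 cT] := rotation_lift n_gt1 rotA_A.
rewrite cyclic_count big_cat big_map big_filter /=; congr (_ + _).
rewrite big_flatten big_map /=.
rewrite (eq_bigr (fun k => (#|J| == k) * cA (prefix k))) => [|k _]; last first.
  by rewrite big_nseq /shape_lift /= size_nseq iter_addn_0.
have [Jk|Jk] := boolP (#|J| \in iota 1 n.-1).
  rewrite (bigD1_seq #|J|) ?iota_uniq //= eqxx mul1n big1 ?addn0 // => k.
  by rewrite eq_sym => /negbTE ->.
rewrite big1_seq => [|k /andP[_ kI]]; last by case: eqP => // e; rewrite e kI in Jk.
(* The sizes 0 and n have no two-piece shape. There the prefix is the empty or the full set, which
   is never a cyclic descent set. *)
have [J0|Jn] : #|J| = 0 \/ #|J| = n.
  have : #|J| <= n by rewrite -[leqRHS]card_ord max_card.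
  by move: Jk; rewrite mem_iota; move: #|J| n_gt1; clear; lia.
- by rewrite J0 -[RHS]c0; apply: eq_count => s; congr (_ == _); apply/setP => i; rewrite !inE.
- by rewrite Jn -[RHS]cT; apply: eq_count => s; congr (_ == _); apply/setP => i; rewrite !inE ltn_ord.
Qed.
End WithLifts.
End CyclicExpansion.

Theorem theorem3p10 (n : nat) (A : {set 'S_n}) :
  (2 <= n)%N -> schur_positive A -> rotA A = A -> cyclic_schur_positive A.
Proof.
move=> n_gt1 [_ [L [L_part L_schur]]] rA.
have [C C_lift] := nonhook_lifts n_gt1 L_part.
exists (shapes A L), (fun sh => lift_cDes sh.1 sh.2 (shape_lift C sh)).
have n0 : 0 < n by apply: ltnW.
have shP := shapesP n_gt1 L_part C_lift.
split=> [sh /shP[skew sz nr lift]|].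
  by split=> //; apply: lift_extension.
(* Grouping both sides by the subset [J] reduces the identity of polynomials to the equality of
   multiplicities in [shapes_count]. *)
rewrite -big_enum /= sum_by_value.
under [RHS]eq_big_seq => sh /shP[_ _ _ lift].
  rewrite sum_by_value; under eq_bigr => J _ do rewrite (count_lift_cDes n0 lift).
  over.
rewrite exchange_big /=; apply: eq_bigr => J _.
by rewrite sumrMnr -(shapes_count n_gt1 rA L_part L_schur C_lift).
Qed.
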